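(* Let $\mathcal B^c=(\mathcal B,\mathcal H)$ be the collared Bratteli diagram associated with a proper nested sequence of tilings $(T_n)_{n\in\mathbb N}$ of $\mathbb R^d$, and let $\Xi$ be the canonical transversal of the tiling space of $T_1$. The groupoid of the equivalence relation $R_{\mathcal B}$ is homeomorphic to $\Gamma_\Xi$, the groupoid of the tiling space.
   Context: **Tilings.** A tile is a compact subset of $\mathbb R^d$ equal to the closure of its interior; every tile is punctured (comes with a distinguished point of it, its puncture) and may carry a label; equality and translation of tiles respect punctures and labels. A patch is a finite set of tiles with pairwise disjoint interiors, whose union is its support; a tiling is a countable set of tiles with pairwise disjoint interiors and union $\mathbb R^d$. Tiles have finite CW-complex structures, and the intersection of two tiles of a tiling is a subcomplex of both. The inner (outer) radius of a tile or patch is the radius of the largest (smallest) ball centered at its puncture contained in (containing) its support. $T$ has FLC if for each $\rho>0$ there are finitely many patches of $T$ of outer radius $<\rho$ up to translation; it is repetitive if for each patch $p\subset T$ there is $\rho_p>0$ such that for every $x\in\mathbb R^d$ some translate of $p$ is a set of tiles of $T$ contained in $B(x,\rho_p)$; it is aperiodic if $T+a\ne T$ for all $a\neq0$. **Hull and tiling groupoid.** For tilings $T,T'$ let $\delta(T,T')=\min(\inf A,1)$, where $A$ is the set of $\varepsilon\in(0,1)$ for which there are $a,a'\in B(0,\varepsilon)$ such that $T+a$ and $T'+a'$ have the same tiles with puncture in $B(0,1/\varepsilon)$. The tiling space $\Omega$ of $T_1$ is the closure of $\{T_1+a: a\in\mathbb R^d\}$, and the canonical transversal $\Xi\subset\Omega$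 is the subset of tilings having a tile with puncture at $0$. For a patch $p$, $\Xi(p)=\{T'\in\Xi: p\subset T'\}$. The equivalence relation of the transversal is $R_\Xi=\{(T,T')\in\Xi\times\Xi:\exists a\in\mathbb R^d,\ T'=T+a\}$, with the topology in which $(T_n,T_n+a_n)\to(T,T+a)$ iff $T_n\to T$ and $a_n\to a$. The groupoid of an equivalence relation $R$ on $X$ is the topological groupoid with objects $X$ and morphisms the pairs $(x,x')\in R$, with the topology of $R$. $\Gamma_\Xi$ is the groupoid of $R_\Xi$: objects $\Xi$, morphisms $\Gamma_\Xi=\{(T,a)\in\Xi\times\mathbb R^d: T+a\in\Xi\}$, where $(T,a)$ corresponds to the pair $(T,T+a)$. **Proper nested sequences.** A nested sequence of tilings is a sequence $(T_n)_{n\ge1}$ of tilings such that for all $n\ge2$ the tiles of $T_n$ are (supports of) patches of $T_{n-1}$; one assumes (without loss of generality) that $T_1$ has a tile with puncture at $0$. The substitution map $\sigma_n$ ($n\ge2$) sends each tile of $T_n$ to the patch of $T_{n-1}$ of which it is the support (tiles of $T_n$ with the same shape but corresponding to different patches are labelled as different); it is extended to translates of tiles by $\sigma_n(t+a)=\sigma_n(t)+a$ and to patches by unions; $\sigma_1$ is the identity. Let $r_n>0$ be the minimum of the inner radii and $R_n$ the maximum of the outer radii of the tiles of $T_n$. The sequence is proper if every $T_n$ is aperiodic, repetitive and has FLC, and for all $n\ge2$: (i) for each tile $t_n\in T_n$, $\sigma_n(t_n)$ is a patch of $T_{n-1}$; (ii) for each tile $t_n\in T_n$, $\sigma_n(t_n)$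 contains a tile of $T_{n-1}$ in the interior of its support; (iii) there is $\rho>0$ independent of $n$ with $r_n>r_{n-1}+\rho$ and $R_n>R_{n-1}+\rho$. **Collars.** For $t\in T_n$, $\mathrm{Col}(t)=\{t'\in T_n:\mathrm{dist}(t,t')\le r_n\}$. A collared prototile of $T_n$ is a class of tiles of $T_n$ that agree, together with their collars, up to translation. There are finitely many; let $t^{(n)}_i$, $i=1,\dots,p_n$, denote their representatives with puncture at $0$ (a collared tile remembers its collar). **Bratteli diagram $\mathcal B=(\mathcal V,\mathcal E,r,s,u)$ of $(T_n)$.** $\mathcal V_0=\{\circ\}$, $\mathcal V_n=\{t^{(n)}_i\}_i$ for $n\ge1$; $\mathcal E_1$ has one edge from $\circ$ to each vertex of $\mathcal V_1$, with label $u=0$; for $n\ge2$, $\mathcal E_n$ has one edge $e$ with $s(e)=t^{(n-1)}_i$, $r(e)=t^{(n)}_j$ for each $a\in\mathbb R^d$ such that the collared tile $t^{(n-1)}_i+a$ is a tile of the patch $\sigma_n(t^{(n)}_j)$, and its label is $u(e)=-a$. $\Pi_n$ is the set of paths $\gamma=(e_1,\dots,e_n)$ with $e_i\in\mathcal E_i$, $r(e_i)=s(e_{i+1})$; $r(\gamma)=r(e_n)$ and $u(\gamma)=\sum_i u(e_i)$. $\partial\mathcal B$ is the set of infinite paths, with the topology inherited from the product of the discrete sets $\mathcal E_n$; $x|_{\Pi_n}$ is the prefix of length $n$ of $x$. For $\gamma\in\Pi_n$ with $r(\gamma)=t$, $p^c_\gamma=\sigma_1\circ\cdots\circ\sigma_n(\mathrm{Col}(t))+u(\gamma)$.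 The canonical homeomorphism $\varphi:\partial\mathcal B\to\Xi$ sends $x$ to the unique element of $\bigcap_n\Xi(p^c_{x|_{\Pi_n}})$. Write $T_x=\varphi(x)$. **Horizontal structure.** $\mathcal H=\bigsqcup_n\mathcal H_n$, $r,s:\mathcal H_n\to\mathcal V_n$: there is an edge $h\in\mathcal H_n$ with $s(h)=t$, $r(h)=t'$ and label $u(h)=a'-a$ whenever there are $a,a'\in\mathbb R^d$ such that the collared tiles $t+a$, $t'+a'$ belong to $T_n$, with $t+a\in\mathrm{Col}(t'+a')$ and $t'+a'\in\mathrm{Col}(t+a)$ (one edge for each triple $(t,t',a'-a)$; trivial edges $t=t'$, $u=0$ allowed). **The relation $R_{\mathcal B}$.** For $e,e'\in\mathcal E_n$, $h\in\mathcal H_{n-1}$, $h'\in\mathcal H_n$, one says $(h,e,e',h')$ is a commutative diagram if $s(h)=s(e)$, $r(h)=s(e')$, $r(e)=s(h')$, $r(e')=r(h')$ and $u(e)+u(h')=u(h)+u(e')$. For $x=(e_n)$, $y=(e'_n)$ in $\partial\mathcal B$, $x\sim y$ means: there are $n_0$ and $h_n\in\mathcal H_n$ for all $n\ge n_0$ such that $(h_{n-1},e_n,e'_n,h_n)$ is a commutative diagram for each $n>n_0$. $R_{\mathcal B}=\{(x,y)\in\partial\mathcal B\times\partial\mathcal B:x\sim y\}$. If $x\sim y$ there is a (unique) vector $a(x,y)\in\mathbb R^d$ with $T_y=T_x+a(x,y)$. Topology of $R_{\mathcal B}$: $(x_n,y_n)\to(x,y)$ iff $x_n\to x$ in $\partial\mathcal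 B$ and $a(x_n,y_n)\to a(x,y)$ in $\mathbb R^d$.
   Formalization: The canonical map from infinite paths to the transversal is assumed injective: the setting calls it a homeomorphism, but this fails for some proper nested sequences (Fibonacci tilings grouped in threes), for which the claim is false. *)

(* Defs.v *)
From HB Require Import structures.
From mathcomp Require Import all_boot all_order all_algebra.
From mathcomp Require Import all_classical all_reals all_analysis.

Set Implicit Arguments.
Unset Strict Implicit.
Unset Printing Implicit Defensive.

Import Order.TTheory GRing.Theory Num.Theory.
Import numFieldNormedType.Exports.

Local Open Scope classical_set_scope.
Local Open Scope ring_scope.

(** * Euclidean geometry of R^d *)

(* The library norm on matrices is the sup norm; balls, radii and distances of
   tilings are Euclidean.  Both induce the library topology of ['rV[R]_d]. *)
Definition enorm (R : realType) (d : nat) (x : 'rV[R]_d) : R :=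
  Num.sqrt (\sum_(i < d) x ord0 i ^+ 2).

Definition eball (R : realType) (d : nat) (x : 'rV[R]_d) (r : R) :
  set 'rV[R]_d := [set y | enorm (y - x) < r].

Definition ecball (R : realType) (d : nat) (x : 'rV[R]_d) (r : R) :
  set 'rV[R]_d := [set y | enorm (y - x) <= r].

Definition esphere (R : realType) (d : nat) (x : 'rV[R]_d) (r : R) :
  set 'rV[R]_d := [set y | enorm (y - x) = r].

Definition euclid_dist (R : realType) (d : nat) (A B : set 'rV[R]_d) : R :=
  inf [set s | exists x y, [/\ A x, B y & s = enorm (x - y)]].

Definition inner_radius (R : realType) (d : nat) (x : 'rV[R]_d)
  (S : set 'rV[R]_d) : R := sup [set r | 0 <= r /\ eball x r `<=` S].

Definition outer_radius (R : realType) (d : nat) (x : 'rV[R]_d)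
  (S : set 'rV[R]_d) : R := inf [set r | 0 <= r /\ S `<=` ecball x r].

(** * Finite CW-complexes in R^d *)

Record cw_data (R : realType) (d : nat) := CWData {
  cw_card : nat;
  cw_dim : 'I_cw_card -> nat;
  cw_char : forall i : 'I_cw_card, 'rV[R]_(cw_dim i) -> 'rV[R]_d
}.

Definition cw_cell (R : realType) (d : nat) (c : cw_data R d)
  (i : 'I_(cw_card c)) : set 'rV[R]_d := @cw_char R d c i @` eball 0 1.

Definition is_cw_structure (R : realType) (d : nat) (S : set 'rV[R]_d)
    (c : cw_data R d) : Prop :=
  [/\ forall i, {within ecball 0 1, continuous (@cw_char R d c i)},
      forall i, set_inj (eball 0 1) (@cw_char R d c i),
      trivIset setT (@cw_cell R d c),
      \bigcup_i @cw_cell R d c i = S &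
      forall i, @cw_char R d c i @` esphere 0 1 `<=`
        \bigcup_(j in [set j | (cw_dim j < cw_dim i)%N]) @cw_cell R d c j].

Definition is_subcomplex (R : realType) (d : nat) (c : cw_data R d)
    (A : set 'rV[R]_d) : Prop :=
  exists2 J : set 'I_(cw_card c), A = \bigcup_(j in J) @cw_cell R d c j &
    forall j, J j -> @cw_char R d c j @` ecball 0 1 `<=` A.

(** * Tiles, patches, tilings *)

Record tile (R : realType) (d : nat) (L : Type) := Tile {
  tile_supp : set 'rV[R]_d;
  tile_punct : 'rV[R]_d;
  tile_label : L
}.

Definition is_tile (R : realType) (d : nat) (L : Type) (t : tile R d L) :
    Prop :=
  [/\ compact (tile_supp t), closure ((tile_supp t)°) = tile_supp t &
      tile_supp t (tile_punct t)].

Definition shift_tile (R : realType) (d : nat) (L : Type) (a : 'rV[R]_d)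
    (t : tile R d L) : tile R d L :=
  Tile [set x + a | x in tile_supp t] (tile_punct t + a) (tile_label t).

Definition tileset (R : realType) (d : nat) (L : Type) : Type :=
  set (tile R d L).

Definition shift_tiles (R : realType) (d : nat) (L : Type) (a : 'rV[R]_d)
    (P : tileset R d L) : tileset R d L := [set shift_tile a t | t in P].

Definition patch_support (R : realType) (d : nat) (L : Type)
    (P : tileset R d L) : set 'rV[R]_d :=
  \bigcup_(t in P) tile_supp t.

Definition nonoverlapping (R : realType) (d : nat) (L : Type)
    (P : tileset R d L) : Prop :=
  forall t t', P t -> P t' -> t <> t' ->
    (tile_supp t)° `&` (tile_supp t')° = set0.

Definition is_patch (R : realType) (d : nat) (L : Type) (p : tileset R d L) :
    Prop :=
  [/\ finite_set p, forall t, p t -> is_tile t & nonoverlapping p].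

Definition patch_of (R : realType) (d : nat) (L : Type) (T p : tileset R d L) :
    Prop := is_patch p /\ p `<=` T.

Definition is_tiling (R : realType) (d : nat) (L : Type) (T : tileset R d L) :
    Prop :=
  [/\ countable T, forall t, T t -> is_tile t, nonoverlapping T &
      patch_support T = setT].

Definition cellular (R : realType) (d : nat) (L : Type) (T : tileset R d L) :
    Prop :=
  exists cw : tile R d L -> cw_data R d,
    (forall t, T t -> is_cw_structure (tile_supp t) (cw t)) /\
    (forall t t', T t -> T t' ->
       is_subcomplex (cw t) (tile_supp t `&` tile_supp t') /\
       is_subcomplex (cw t') (tile_supp t `&` tile_supp t')).

(* A patch is punctured at the puncture of one of its tiles, here [t]. *)
Definition flc (R : realType) (d : nat) (L : Type) (T : tileset R d L) :
    Prop :=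
  forall rho : R, 0 < rho ->
  exists2 F : set (tileset R d L), finite_set F &
    forall p t, patch_of T p -> p t ->
      outer_radius (tile_punct t) (patch_support p) < rho ->
      exists2 q, F q & exists a, p = shift_tiles a q.

Definition repetitive (R : realType) (d : nat) (L : Type)
    (T : tileset R d L) : Prop :=
  forall p, patch_of T p ->
  exists2 rho : R, 0 < rho &
    forall x, exists a,
      shift_tiles a p `<=` T /\
      patch_support (shift_tiles a p) `<=` eball x rho.

Definition aperiodic (R : realType) (d : nat) (L : Type)
    (T : tileset R d L) : Prop :=
  forall a, a <> 0 -> shift_tiles a T <> T.

(** * Hull, canonical canonical_transversal and tiling groupoid *)

Section TilingMetric.
Variables (R : realType) (d : nat) (L : Type).
Implicit Types T U : tileset R d L.

Definition agree_on (r : R) T U : Prop :=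
  forall t, enorm (tile_punct t) < r -> T t <-> U t.

(* [1] is added to the set because [min (inf A, 1)] is meant with
   [inf set0 = +oo], whereas the library has [inf set0 = 0]. *)
Definition tiling_dist T U : R :=
  inf ([set e | [/\ 0 < e, e < 1 &
         exists a a', [/\ eball 0 e a, eball 0 e a' &
           agree_on e^-1 (shift_tiles a T) (shift_tiles a' U)]]] `|` [set 1]).

Definition tiling_open (O : set (tileset R d L)) : Prop :=
  forall T, O T -> exists2 e : R, 0 < e &
    forall U, tiling_dist T U < e -> O U.

Lemma tiling_openT : tiling_open setT.
Proof. by move=> T _; exists 1. Qed.

Lemma tiling_openI (A B : set (tileset R d L)) :
  tiling_open A -> tiling_open B -> tiling_open (A `&` B).
Proof.
move=> oA oB T [/oA[e e0 eA] /oB[f f0 fB]].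
exists (Num.min e f); first by rewrite lt_min e0 f0.
by move=> U; rewrite lt_min => /andP[/eA ? /fB ?].
Qed.

Lemma tiling_open_bigU (I : Type) (f : I -> set (tileset R d L)) :
  (forall i, tiling_open (f i)) -> tiling_open (\bigcup_i f i).
Proof.
move=> of_ T [i _ /of_[e e0 eA]]; exists e => // U /eA fU.
by exists i.
Qed.

HB.instance Definition _ := gen_eqMixin (tileset R d L).
HB.instance Definition _ := gen_choiceMixin (tileset R d L).
HB.instance Definition _ :=
  isOpenTopological.Build (tileset R d L)
    tiling_openT tiling_openI tiling_open_bigU.

End TilingMetric.

Definition hull (R : realType) (d : nat) (L : Type) (T1 : tileset R d L) :
    set (tileset R d L) :=
  [set T | is_tiling T] `&` closure [set T | exists a, T = shift_tiles a T1].

Definition canonical_transversal (R : realType) (d : nat) (L : Type)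
    (T1 : tileset R d L) : set (tileset R d L) :=
  [set T | hull T1 T /\ exists2 t, T t & tile_punct t = 0].

Definition transversal_at (R : realType) (d : nat) (L : Type)
    (T1 p : tileset R d L) : set (tileset R d L) :=
  [set T | canonical_transversal T1 T /\ p `<=` T].

(** * Topological groupoids *)

(* [gcomp g h k] means that [(g, h)] is composable, with composite [k].  An
   isomorphism preserving source, target and composition also preserves units
   and inverses. *)
Record top_groupoid := TopGroupoid {
  gobj : topologicalType;
  gmor : topologicalType;
  gsrc : gmor -> gobj;
  gtgt : gmor -> gobj;
  gcomp : gmor -> gmor -> gmor -> Prop
}.

Definition homeomorphism (X Y : topologicalType) (f : X -> Y) : Prop :=
  continuous f /\
  exists g : Y -> X, [/\ continuous g, cancel f g & cancel g f].

Definition groupoid_homeomorphic (G H : top_groupoid) : Prop :=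
  exists (f0 : gobj G -> gobj H) (f : gmor G -> gmor H),
    [/\ homeomorphism f0 /\ homeomorphism f,
        forall g, gsrc (f g) = f0 (gsrc g),
        forall g, gtgt (f g) = f0 (gtgt g) &
        forall g h k, gcomp g h k <-> gcomp (f g) (f h) (f k)].

Section TilingGroupoid.
Variables (R : realType) (d : nat) (L : Type) (T1 : tileset R d L).

Let Xi : set (tileset R d L) := canonical_transversal T1.

Definition tiling_mor : set (tileset R d L * 'rV[R]_d) :=
  [set g | Xi g.1 /\ Xi (shift_tiles g.2 g.1)].

Definition tiling_src (g : tiling_mor) : Xi :=
  exist _ (val g).1 (mem_set (set_mem (valP g)).1).

Definition tiling_tgt (g : tiling_mor) : Xi :=
  exist _ (shift_tiles (val g).2 (val g).1) (mem_set (set_mem (valP g)).2).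

Definition tiling_comp (g h k : tiling_mor) : Prop :=
  [/\ tiling_tgt g = tiling_src h, tiling_src k = tiling_src g &
      (val k).2 = (val g).2 + (val h).2].

Definition tiling_groupoid : top_groupoid :=
  TopGroupoid tiling_src tiling_tgt tiling_comp.

End TilingGroupoid.

(** * Proper nested sequences *)

(* Sequences are indexed from 1: [T 0] and [sigma 0] are never used. *)

Definition min_radius (R : realType) (d : nat) (L : Type)
    (T : nat -> tileset R d L) (n : nat) : R :=
  inf [set inner_radius (tile_punct t) (tile_supp t) | t in T n].

Definition max_radius (R : realType) (d : nat) (L : Type)
    (T : nat -> tileset R d L) (n : nat) : R :=
  sup [set outer_radius (tile_punct t) (tile_supp t) | t in T n].

(* [ns_shift] is the extension of [sigma] to translates; that it is consistent
   is what the labelling convention means: tiles of [T n.+1] that are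
   translates of each other, label included, stand for translates of the same
   patch of [T n].  The patch [sigma n.+1 t] is determined by its support, since
   distinct tiles of [T n] have disjoint interiors.  A single label type serves
   for all the [T n]. *)
Record nested_sequence (R : realType) (d : nat) (L : Type)
    (T : nat -> tileset R d L) (sigma : nat -> tile R d L -> tileset R d L) :
    Prop := NestedSequence {
  ns_tiling : forall n, (0 < n)%N -> is_tiling (T n);
  ns_cellular : forall n, (0 < n)%N -> cellular (T n);
  ns_patch : forall n t, (0 < n)%N -> T n.+1 t ->
    patch_of (T n) (sigma n.+1 t) /\ patch_support (sigma n.+1 t) = tile_supp t;
  ns_shift : forall n t a, (0 < n)%N -> T n.+1 t ->
    sigma n.+1 (shift_tile a t) = shift_tiles a (sigma n.+1 t);
  ns_sigma1 : forall t, sigma 1%N t = [set t];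
  ns_origin : exists2 t, T 1%N t & tile_punct t = 0
}.

Record proper_nested_sequence (R : realType) (d : nat) (L : Type)
    (T : nat -> tileset R d L) (sigma : nat -> tile R d L -> tileset R d L) :
    Prop := ProperNestedSequence {
  pns_nested : nested_sequence T sigma;
  pns_radius : forall n, (0 < n)%N -> 0 < min_radius T n;
  pns_aperiodic : forall n, (0 < n)%N -> aperiodic (T n);
  pns_repetitive : forall n, (0 < n)%N -> repetitive (T n);
  pns_flc : forall n, (0 < n)%N -> flc (T n);
  pns_patch : forall n t, (0 < n)%N -> T n.+1 t ->
    patch_of (T n) (sigma n.+1 t);
  pns_interior : forall n t, (0 < n)%N -> T n.+1 t ->
    exists2 t', sigma n.+1 t t' &
      tile_supp t' `<=` (patch_support (sigma n.+1 t))°;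
  pns_growth : exists2 rho : R, 0 < rho & forall n, (0 < n)%N ->
    min_radius T n.+1 > min_radius T n + rho /\
    max_radius T n.+1 > max_radius T n + rho
}.

(** * The collared Bratteli diagram *)

(* A collared tile: a tile with its collar. *)
Definition ctile (R : realType) (d : nat) (L : Type) : Type :=
  (tile R d L * tileset R d L)%type.

(* [None] is the root of the diagram. *)
Definition vertex (R : realType) (d : nat) (L : Type) : Type :=
  option (ctile R d L).

(* Vertical and horizontal edges alike are determined by source, range and
   label. *)
Record edge (R : realType) (d : nat) (L : Type) := Edge {
  esrc : vertex R d L;
  erng : vertex R d L;
  elab : 'rV[R]_d
}.

HB.instance Definition _ (R : realType) (d : nat) (L : Type) :=
  gen_eqMixin (edge R d L).
HB.instance Definition _ (R : realType) (d : nat) (L : Type) :=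
  gen_choiceMixin (edge R d L).

Section BratteliDiagram.
Variables (R : realType) (d : nat) (L : Type).
Variables (T : nat -> tileset R d L).
Variables (sigma : nat -> tile R d L -> tileset R d L).

Definition collar (n : nat) (t : tile R d L) : tileset R d L :=
  [set t' | T n t' /\
    euclid_dist (tile_supp t) (tile_supp t') <= min_radius T n].

(* The collared tile [v + a] is a collared tile of [T n]. *)
Definition occurs (n : nat) (v : ctile R d L) (a : 'rV[R]_d) : Prop :=
  T n (shift_tile a v.1) /\ collar n (shift_tile a v.1) = shift_tiles a v.2.

Definition vertices (n : nat) : set (vertex R d L) :=
  match n with
  | 0%N => [set None]
  | _ => [set v | exists w a,
      [/\ v = Some w, tile_punct w.1 = 0 & occurs n w a]]
  end.

(* The collar of a tile of [sigma n.+1 w] is read off at an occurrence [w + b]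
   of [w] in [T n.+1]; it does not depend on the occurrence. *)
Definition vertical_edges (n : nat) : set (edge R d L) :=
  match n with
  | 0%N => set0
  | 1%N => [set e | [/\ esrc e = None, vertices 1 (erng e) & elab e = 0]]
  | m.+1 => [set e | [/\ vertices m (esrc e), vertices m.+1 (erng e) &
      exists v w (a b : 'rV[R]_d), [/\ esrc e = Some v, erng e = Some w, elab e = - a,
        occurs m.+1 w b &
        sigma m.+1 (shift_tile b w.1) (shift_tile (a + b) v.1) /\
        occurs m v (a + b)]]]
  end.

Definition horizontal_edges (n : nat) : set (edge R d L) :=
  [set h | [/\ vertices n (esrc h), vertices n (erng h) &
    exists v w (a a' : 'rV[R]_d),
      [/\ esrc h = Some v /\ erng h = Some w, elab h = a' - a,
          occurs n v a /\ occurs n w a',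
          collar n (shift_tile a' w.1) (shift_tile a v.1) &
          collar n (shift_tile a v.1) (shift_tile a' w.1)]]].

(* The term of index [n] of an infinite path [(e_1, e_2, ...)] is [e_(n+1)]. *)
Definition edge_sequence : Type :=
  prod_topology (fun _ : nat => discrete_topology (edge R d L)).

HB.instance Definition _ := Topological.on edge_sequence.

Definition path_space : set edge_sequence :=
  [set x | forall n, vertical_edges n.+1 (x n) /\ erng (x n) = esrc (x n.+1)].

Definition path_range (gamma : seq (edge R d L)) : vertex R d L :=
  last None [seq erng e | e <- gamma].

Definition path_label (gamma : seq (edge R d L)) : 'rV[R]_d :=
  \sum_(e <- gamma) elab e.

(* [sigma_1 o ... o sigma_n] on sets of tiles. *)
Fixpoint sigma_comp (n : nat) (P : tileset R d L) : tileset R d L :=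
  match n with
  | 0%N => P
  | m.+1 => sigma_comp m (\bigcup_(t in P) sigma m.+1 t)
  end.

Definition collar_patch (gamma : seq (edge R d L)) : tileset R d L :=
  shift_tiles (path_label gamma)
    (sigma_comp (size gamma)
      (if path_range gamma is Some v then v.2 else set0)).

(* The map [phi], i.e. [x |-> T_x]: the unique element of the intersection of
   the [Xi(p^c_(x|n))].  Its injectivity means that the hierarchical structure
   can be recovered from the tilings of the transversal (recognizability).  It
   does not follow from properness: grouping the letters of a Fibonacci tiling
   by three, then by three again, and so on, gives a proper nested sequence for
   which [phi] forgets a 3-adic integer. *)
Definition path_tiling (x : path_space) : tileset R d L :=
  xget set0 (\bigcap_(n in [set n | (0 < n)%N])
    transversal_at (T 1) (collar_patch (mkseq (val x) n))).

Definition commutative_diagram (h e e' h' : edge R d L) : Prop :=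
  [/\ esrc h = esrc e, erng h = esrc e', erng e = esrc h', erng e' = erng h' &
      elab e + elab h' = elab h + elab e'].

Definition path_equiv (x y : path_space) : Prop :=
  exists (n0 : nat) (h : nat -> edge R d L),
    (forall n, (n0 <= n)%N -> horizontal_edges n (h n)) /\
    (forall n, (n0 < n)%N ->
       commutative_diagram (h n.-1) (val x n.-1) (val y n.-1) (h n)).

(* The unique [a] with [T_y = T_x + a], when [x ~ y]. *)
Definition path_vector (x y : path_space) : 'rV[R]_d :=
  xget 0 [set a | path_tiling y = shift_tiles a (path_tiling x)].

Definition bratteli_rel : set (path_space * path_space) :=
  [set g | path_equiv g.1 g.2].

Definition bratteli_mor : topologicalType :=
  initial_topology (fun g : bratteli_rel =>
    ((val g).1, path_vector (val g).1 (val g).2) : path_space * 'rV[R]_d).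

Definition bratteli_src (g : bratteli_mor) : path_space :=
  (val (g : bratteli_rel)).1.

Definition bratteli_tgt (g : bratteli_mor) : path_space :=
  (val (g : bratteli_rel)).2.

Definition bratteli_comp (g h k : bratteli_mor) : Prop :=
  [/\ bratteli_tgt g = bratteli_src h, bratteli_src k = bratteli_src g &
      bratteli_tgt k = bratteli_tgt h].

Definition bratteli_groupoid : top_groupoid :=
  TopGroupoid bratteli_src bratteli_tgt bratteli_comp.

End BratteliDiagram.

(* Main.v *)
(** Write [anc_n s] for the tile of [T (n+1)] containing the tile [s] of [T 1].
    The collared tiles [anc_0 s, anc_1 s, ...] form a path of the diagram, whose
    patch at level [n] is, up to the translation moving [s] to the origin, the set
    of the tiles [t] of [T 1] with [anc_n t] in the collar of [anc_n s].  Every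
    finite path is the prefix of such a path, so [T_x] agrees on larger and larger
    balls with translates of [T 1] having their origin in suitable tiles.

    The diagram is finite at each level, so path space is compact: if the tilings
    of a sequence of paths converge to a tiling [U], then a cluster point [y] of
    the sequence satisfies [T_y = U].  This gives the surjectivity of
    [x |-> T_x], the continuity of its inverse, and the fact that [T_y = T_x + c]
    implies [x ~ y]: the tiles of [T 1] approximating the origin of [T_y] inside
    [T_x] yield paths whose cluster point is [y] by injectivity, so that prefixes
    of [x] and [y] of any length occur in [T 1] at relative position [- c], and
    the corresponding supertiles of level [n] are in each other's collars as soon
    as [|c| <= r_n].  Since tilings of the hull are aperiodic, morphisms of both
    groupoids are pairs of equivalent objects. *)

Require Import Defs.
From mathcomp Require Import all_boot all_order all_algebra.
From mathcomp Require Import all_classical all_reals all_analysis.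
From mathcomp Require Import finmap ring lra.

Set Implicit Arguments.
Unset Strict Implicit.
Unset Printing Implicit Defensive.

Import Order.TTheory GRing.Theory Num.Theory.
Import numFieldNormedType.Exports.

Local Open Scope classical_set_scope.
Local Open Scope ring_scope.

(** * The Euclidean norm and its comparison with the library topology *)

Section Euclid.
Variables (R : realType) (d : nat).
Implicit Types x y z : 'rV[R]_d.

Lemma enorm_ge0 x : 0 <= enorm x.
Proof. exact: sqrtr_ge0. Qed.

Lemma enorm_sqr x : enorm x ^+ 2 = \sum_(i < d) x ord0 i ^+ 2.
Proof. by rewrite sqr_sqrtr // sumr_ge0 // => i _; exact: sqr_ge0. Qed.

Lemma enorm0 : enorm (0 : 'rV[R]_d) = 0.
Proof.
by rewrite /enorm big1 ?sqrtr0 // => i _; rewrite mxE expr0n.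
Qed.

Lemma enormN x : enorm (- x) = enorm x.
Proof. by congr Num.sqrt; apply: eq_bigr => i _; rewrite mxE sqrrN. Qed.

Lemma enormB x y : enorm (x - y) = enorm (y - x).
Proof. by rewrite -enormN opprB. Qed.

Lemma coord_le_enorm x i : `|x ord0 i| <= enorm x.
Proof.
rewrite -sqrtr_sqr ler_sqrt (bigD1 i) //= ?lerDl ?addr_ge0 ?sqr_ge0 //;
by rewrite sumr_ge0 // => j _; exact: sqr_ge0.
Qed.

Lemma cauchy_schwarz x y :
  \sum_(i < d) x ord0 i * y ord0 i <= enorm x * enorm y.
Proof.
have [x0|x0] := eqVneq (enorm x) 0.
  rewrite x0 mul0r big1 // => i _; have := coord_le_enorm x i.
  by rewrite x0 normr_le0 => /eqP ->; rewrite mul0r.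
have [y0|y0] := eqVneq (enorm y) 0.
  rewrite y0 mulr0 big1 // => i _; have := coord_le_enorm y i.
  by rewrite y0 normr_le0 => /eqP ->; rewrite mulr0.
have xy0 : 0 < enorm x * enorm y by rewrite mulr_gt0 // lt0r ?x0 ?y0 enorm_ge0.
(* This sum equals [2 |x| |y| (|x| |y| - <x, y>)]; the positive factor cancels. *)
have : 0 <= \sum_(i < d) (enorm y * x ord0 i - enorm x * y ord0 i) ^+ 2.
  by rewrite sumr_ge0 // => i _; exact: sqr_ge0.
have -> : \sum_(i < d) (enorm y * x ord0 i - enorm x * y ord0 i) ^+ 2 =
    enorm y ^+ 2 * (\sum_(i < d) x ord0 i ^+ 2)
    - (enorm x * enorm y) * (\sum_(i < d) x ord0 i * y ord0 i) *+ 2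
    + enorm x ^+ 2 * (\sum_(i < d) y ord0 i ^+ 2).
  rewrite !mulr_sumr -sumrMnl -sumrB -big_split /=.
  by apply: eq_bigr => i _; ring.
rewrite -!enorm_sqr => h.
by rewrite -(ler_pM2l xy0); lra.
Qed.

Lemma enormD x y : enorm (x + y) <= enorm x + enorm y.
Proof.
rewrite -(@ler_pXn2r _ 2) ?nnegrE ?addr_ge0 ?enorm_ge0 //.
rewrite sqrrD !enorm_sqr.
have -> : \sum_(i < d) (x + y) ord0 i ^+ 2 = \sum_(i < d) x ord0 i ^+ 2 +
   (\sum_(i < d) x ord0 i * y ord0 i) *+ 2 + \sum_(i < d) y ord0 i ^+ 2.
  by rewrite -sumrMnl -!big_split /=; apply: eq_bigr => i _; rewrite mxE sqrrD.
by rewrite lerD2r lerD2l lerMn2r cauchy_schwarz orbT.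
Qed.

Lemma enorm_dist x y z : enorm (x - z) <= enorm (x - y) + enorm (y - z).
Proof. by rewrite -{1}(subrK y x) -addrA enormD. Qed.

Lemma norm_le_enorm x : `|x| <= enorm x.
Proof.
rewrite [ `|x| ]mx_normrE; apply: bigmax_le; first exact: enorm_ge0.
by move=> [i j] _ /=; rewrite ord1 coord_le_enorm.
Qed.

Lemma enorm_le_norm x : enorm x <= d%:R * `|x|.
Proof.
rewrite -(@ler_pXn2r _ 2) ?nnegrE ?mulr_ge0 ?enorm_ge0 // enorm_sqr.
apply: (@le_trans _ _ (\sum_(i < d) `|x| ^+ 2)).
  apply: ler_sum => i _; rewrite -real_normK ?num_real // ler_pXn2r ?nnegrE //.
  rewrite [ `|x| ]mx_normrE.
  by apply: (le_bigmax_cond 0 (fun ij : 'I_1 * 'I_d => `|x ij.1 ij.2|)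
    (j := (ord0, i))).
rewrite sumr_const card_ord -[leLHS]mulr_natl [leRHS]exprMn.
apply: ler_wpM2r; first exact: sqr_ge0.
by rewrite expr2 -natrM ler_nat; case: (d) => // n; rewrite leq_pmulr.
Qed.

Lemma nbhs_eball x y r : enorm (x - y) < r -> nbhs x (eball y r).
Proof.
move=> xyr; have d0 : 0 < (d%:R + 1 : R) by rewrite ltr_wpDl.
(* The [+ 1] keeps the denominator nonzero in dimension [0]. *)
apply/nbhs_ballP; exists ((r - enorm (x - y)) / (d%:R + 1)) => /=.
  by rewrite divr_gt0 // subr_gt0.
move=> z; rewrite -ball_normE /= ltr_pdivlMr // => xz; rewrite /eball /=.
apply: (le_lt_trans (enorm_dist z x y)); rewrite -ltrBrDr enormB.
apply: le_lt_trans xz; apply: le_trans (enorm_le_norm _) _.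
by rewrite [leRHS]mulrC ler_wpM2r // lerDl.
Qed.

Lemma compact_eball (A : set 'rV[R]_d) x :
  compact A -> exists2 r, 0 < r & A `<=` eball x r.
Proof.
move=> /compact_bounded[M [_ /(_ (`|M| + 1))]].
rewrite (le_lt_trans (ler_norm M)) ?ltrDl // => /(_ isT) AM.
exists (d%:R * (`|M| + 1) + enorm x + 1) => [|y Ay].
  by rewrite ltr_wpDl // addr_ge0 ?enorm_ge0 // mulr_ge0 // addr_ge0.
rewrite /eball /=; apply: (le_lt_trans (enormD _ _)).
rewrite enormN ltr_pwDr // lerD2r; apply: le_trans (enorm_le_norm _) _.
by rewrite ler_wpM2l //; exact: AM.
Qed.

(* Compactness: a ball of radius [r / 2] contains at most one of the points. *)
Lemma separated_finite (I : Type) (A : set I) (f : I -> 'rV[R]_d) (r B : R) :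
  0 < r -> (forall i, A i -> enorm (f i) <= B) ->
  (forall i j, A i -> A j -> enorm (f i - f j) < r -> i = j) ->
  finite_set A.
Proof.
move=> r0 fB fsep.
pose K : set 'rV[R]_d := [set x | `|x| <= B].
have cK : compact K.
  apply: bounded_closed_compact.
    exists B; split; rewrite ?num_real // => M BM x Kx.
    exact: le_trans Kx (ltW BM).
  have -> : K = closed_ball_ Num.norm (0 : 'rV[R]_d) B.
    by apply/seteqP; split => x; rewrite /K /closed_ball_ /= sub0r normrN.
  exact: closed_closed_ball_.
move: cK; rewrite compact_cover => /(_ _ setT (fun x => (eball x (r / 2))°)).
case=> [x _|x Kx|D _ KD].
- exact: open_interior.
- exists x => //; apply: nbhs_singleton; apply: nbhs_interior.
  by apply: nbhs_eball; rewrite subrr enorm0 divr_gt0.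
have inB i : A i -> exists2 x, x \in D & eball x (r / 2) (f i).
  move=> Ai; have [|x Dx /interior_subset ?] := KD (f i); last by exists x.
  exact: le_trans (norm_le_enorm _) (fB i Ai).
have [[i0 _]|A0] := pselect (A !=set0); last first.
  by rewrite (_ : A = set0) //; apply/seteqP; split => // i Ai; case: A0; exists i.
(* One index is chosen for each centre of the finite subcover; [i0] is only a default value. *)
pose g x := if pselect (exists i, A i /\ eball x (r / 2) (f i)) is left e
  then sval (cid e) else i0.
apply: (@sub_finite_set _ _ (g @` [set` D])); last first.
  exact/finite_image/finite_fset.
move=> i Ai; have [x Dx xi] := inB i Ai; exists x => //.
rewrite /g; case: pselect => [e|[]]; last by exists i.
case: cid => j [/= Aj xj]; apply: fsep => //; apply: le_lt_trans (enorm_dist _ x _) _.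
by move: xi xj; rewrite /eball /= (enormB x (f i)) => xi xj; lra.
Qed.

End Euclid.

(** * Translates of sets, their interiors and closures *)

Section Translation.
Variables (R : realType) (d : nat).
Implicit Types (A B S : set 'rV[R]_d) (a x y : 'rV[R]_d).

Lemma shift_setE S a : [set x + a | x in S] = (fun y => y - a) @^-1` S.
Proof.
apply/seteqP; split => [_ [x Sx <-]|y Sy] /=; first by rewrite addrK.
by exists (y - a) => //; rewrite subrK.
Qed.

Lemma shift_continuous a : continuous (fun z : 'rV[R]_d => z + a).
Proof.
move=> z; apply: (@continuousD _ _ _ id (cst a)); first by move=> A.
exact: cst_continuous.
Qed.

Lemma shift_set_nbhs S a y : nbhs y [set x + a | x in S] <-> nbhs (y - a) S.
Proof.
rewrite shift_setE; split => h; last by have := @shift_continuous (- a) y; apply.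
have -> : S = (fun z => z + a) @^-1` ((fun z => z - a) @^-1` S).
  by apply/seteqP; split => z /=; rewrite addrK.
by have := @shift_continuous a (y - a); apply; rewrite /= subrK.
Qed.

Lemma shift_set_interior S a :
  [set x + a | x in S]° = [set x + a | x in S°].
Proof.
by apply/seteqP; split => y; rewrite (shift_setE S°);
  [move=> /shift_set_nbhs|move=> ?; apply/shift_set_nbhs].
Qed.

Lemma shift_set_closure S a :
  closure [set x + a | x in S] = [set x + a | x in closure S].
Proof.
apply/seteqP; split => y; rewrite (shift_setE (closure S)) => cy B nB.
- have [|_ [[x Sx <-] [z Bz /addIr zx]]] := cy [set x + a | x in B].
    by apply/shift_set_nbhs.
  by exists x; split => //; rewrite -zx.
- have [|x [Sx [x' Bx' xE]]] := cy [set x - a | x in B].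
    by apply/shift_set_nbhs; rewrite opprK subrK.
  by exists x'; split => //; rewrite shift_setE /= xE.
Qed.

End Translation.

(** * Distance between sets *)

Section EuclidDist.
Variables (R : realType) (d : nat).
Implicit Types (A B : set 'rV[R]_d) (a x y : 'rV[R]_d).

Let dist_lb A B :
  has_lbound [set s | exists x y, [/\ A x, B y & s = enorm (x - y)]].
Proof. by exists 0 => _ [x [y [_ _ ->]]]; exact: enorm_ge0. Qed.

Lemma euclid_dist_le A B x y : A x -> B y -> euclid_dist A B <= enorm (x - y).
Proof. by move=> Ax By; apply: ge_inf; [exact: dist_lb|exists x, y]. Qed.

(** Nonemptiness excludes the default value [inf set0 = 0], for which no pair of points exists. *)
Lemma euclid_dist_lt A B (r : R) : A !=set0 -> B !=set0 ->
  euclid_dist A B < r -> exists x y, [/\ A x, B y & enorm (x - y) < r].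
Proof.
move=> [x Ax] [y By] dr.
have [|_ [x' [y' [? ? ->]]] ?] := inf_lt _ dr; last by exists x', y'.
by exists (enorm (x - y)), x, y.
Qed.

Lemma euclid_dist_sub A B A' B' : A !=set0 -> B !=set0 -> A `<=` A' ->
  B `<=` B' -> euclid_dist A' B' <= euclid_dist A B.
Proof.
move=> [x Ax] [y By] AA' BB'; apply: lb_le_inf.
  by exists (enorm (x - y)), x, y.
by move=> _ [x' [y' [? ? ->]]]; apply: euclid_dist_le; auto.
Qed.

Lemma euclid_dist_shift A B a :
  euclid_dist [set x + a | x in A] [set x + a | x in B] = euclid_dist A B.
Proof.
congr inf; apply/seteqP; split => s /=.
  move=> [_ [_ [[x Ax <-] [y By <-] ->]]]; exists x, y; split => //.
  by rewrite opprD addrACA subrr addr0.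
move=> [x [y [Ax By ->]]]; exists (x + a), (y + a).
by split; [exists x|exists y|rewrite opprD addrACA subrr addr0].
Qed.

End EuclidDist.

(** * Inner and outer radii *)

Section Radii.
Variables (R : realType) (d : nat).
Implicit Types (S : set 'rV[R]_d) (x : 'rV[R]_d).

(** If the admissible radii have no supremum, [sup] is [0] by default, and [0 <= r] contradicts the
    bound on [r]. *)
Lemma eball_inner_radius S x (r : R) :
  0 <= r -> r < inner_radius x S -> eball x r `<=` S.
Proof.
move=> r0 rS; rewrite /inner_radius in rS.
have [hs|/sup_out s0] := pselect (has_sup [set r | 0 <= r /\ eball x r `<=` S]).
  have rS' : 0 < inner_radius x S - r by rewrite subr_gt0.
  have [s [_ sS]] := sup_adherent rS' hs; rewrite subKr => rs y yr; apply: sS.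
  exact: lt_trans yr rs.
by move: rS; rewrite s0 ltNge r0.
Qed.

Lemma inner_radius_ge0 S x : 0 <= inner_radius x S.
Proof.
rewrite /inner_radius; set E := [set r | _].
have [hs|/sup_out -> //] := pselect (has_sup E).
have [[r Er] _] := hs; have [r0 _] := Er.
exact: le_trans r0 (sup_upper_bound hs Er).
Qed.

Lemma outer_radius_ge0 S x : 0 <= outer_radius x S.
Proof.
rewrite /outer_radius; set E := [set r | _].
have [|/nonemptyPn ->] := pselect (E !=set0); last by rewrite inf0.
by move=> E0; apply: lb_le_inf => // r [].
Qed.

Lemma outer_radius_le S x (r : R) :
  0 <= r -> S `<=` ecball x r -> outer_radius x S <= r.
Proof. by move=> r0 Sr; apply: ge_inf; [exists 0 => s []|]. Qed.

(** Compactness makes the set of admissible radii nonempty, so that its infimum is a genuine one. *)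
Lemma sub_eball_outer_radius S x (r : R) : compact S -> outer_radius x S < r ->
  S `<=` eball x r.
Proof.
move=> cS Sr'; have [|s [s0 Ss] sr y Sy] := inf_lt _ Sr'; last first.
  by apply: le_lt_trans sr; exact: Ss.
have [r' r'0 Sr] := compact_eball x cS.
by exists r'; split; [exact: ltW|move=> y /Sr /ltW].
Qed.

End Radii.

(** * Translations of tiles and rigidity of tilings *)

Section Tiles.
Variables (R : realType) (d : nat) (L : Type).
Implicit Types (t : tile R d L) (P U V : tileset R d L) (a b : 'rV[R]_d).

Lemma shift_tile0 t : shift_tile 0 t = t.
Proof.
case: t => S p l; rewrite /shift_tile /= addr0; congr Tile.
by rewrite shift_setE; apply/seteqP; split => x /=; rewrite subr0.
Qed.

Lemma shift_tileD a b t : shift_tile a (shift_tile b t) = shift_tile (b + a) t.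
Proof.
case: t => S p l; rewrite /shift_tile /= addrA; congr Tile.
rewrite !shift_setE; apply/seteqP; split => x /=.
  by rewrite -addrA -opprD [a + b]addrC.
by rewrite -addrA -opprD [a + b]addrC.
Qed.

Lemma shift_tileK a : cancel (@shift_tile R d L a) (shift_tile (- a)).
Proof. by move=> t; rewrite shift_tileD subrr shift_tile0. Qed.

Lemma shift_tileVK a : cancel (@shift_tile R d L (- a)) (shift_tile a).
Proof. by move=> t; rewrite shift_tileD addNr shift_tile0. Qed.

Lemma shift_tile_inj a : injective (@shift_tile R d L a).
Proof. exact: can_inj (shift_tileK a). Qed.

Lemma shift_tilesE a P : shift_tiles a P = [set t | P (shift_tile (- a) t)].
Proof.
apply/seteqP; split => [_ [t Pt <-]|t Pt] /=; first by rewrite shift_tileK.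
by exists (shift_tile (- a) t) => //; rewrite shift_tileVK.
Qed.

Lemma shift_tiles_mem a P t : P t -> shift_tiles a P (shift_tile a t).
Proof. by exists t. Qed.

Lemma shift_tiles0 P : shift_tiles 0 P = P.
Proof.
by rewrite shift_tilesE; apply/seteqP; split => t /=; rewrite oppr0 shift_tile0.
Qed.

Lemma shift_tilesD a b P : shift_tiles a (shift_tiles b P) = shift_tiles (b + a) P.
Proof.
rewrite !shift_tilesE; apply/seteqP; split => t /=;
by rewrite shift_tileD -opprD [a + b]addrC.
Qed.

Lemma shift_tilesS a P U : P `<=` U -> shift_tiles a P `<=` shift_tiles a U.
Proof. exact: image_subset. Qed.

Lemma is_tile_interior t : is_tile t -> (tile_supp t)° !=set0.
Proof.
move=> [_ ct tp].
have /(_ setT filterT)[z [zt _]] : closure (tile_supp t)° (tile_punct t).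
  by rewrite ct.
by exists z.
Qed.

Lemma is_tile_shift a t : is_tile t -> is_tile (shift_tile a t).
Proof.
move=> [ct clt pt]; split => /=.
- apply: continuous_compact => //; apply: continuous_subspaceT.
  exact: shift_continuous.
- by rewrite shift_set_interior shift_set_closure clt.
- by exists (tile_punct t).
Qed.

(** As [t'] is the closure of its interior, a point of [t'] interior to [t] makes the two interiors
    meet. *)
Lemma overlap_eq U t t' z : nonoverlapping U -> U t -> U t' -> is_tile t' ->
  (tile_supp t)° z -> tile_supp t' z -> t = t'.
Proof.
move=> oU Ut Ut' [_ ct' _] zt; rewrite -{1}ct' => zt'.
apply: contrapT => /(oU _ _ Ut Ut') tt'.
have [|w [wt' wt]] := zt' (tile_supp t)°; first exact: nbhs_interior.
by have : ((tile_supp t)° `&` (tile_supp t')°) w by []; rewrite tt'.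
Qed.

Lemma nonoverlapping_sub U V : U `<=` V -> nonoverlapping V -> nonoverlapping U.
Proof. by move=> UV oV t t' /UV Vt /UV Vt'; exact: oV. Qed.

Lemma is_tiling_shift a U : is_tiling U -> is_tiling (shift_tiles a U).
Proof.
move=> [cU tU oU sU]; split.
- exact: card_le_trans (card_image_le _ _) cU.
- by move=> _ [t Ut <-]; exact/is_tile_shift/tU.
- move=> _ _ [t Ut <-] [t' Ut' <-] tt' /=.
  rewrite !shift_set_interior !shift_setE -preimage_setI oU ?preimage_set0 //.
  by move=> e; apply: tt'; rewrite e.
- apply/seteqP; split => // y _.
  have : patch_support U (y - a) by rewrite sU.
  move=> [t Ut ty]; exists (shift_tile a t); first exact: shift_tiles_mem.
  by exists (y - a) => //; rewrite subrK.
Qed.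

Lemma tiling_cover U y : is_tiling U -> exists2 t, U t & tile_supp t y.
Proof.
move=> [_ _ _ sU]; have : patch_support U y by rewrite sU.
by case=> t; exists t.
Qed.

(** An interior point of a tile of [V] is covered by a tile of [U], which overlaps it in [V] and
    hence equals it. Later identifications of tilings are thereby reduced to one inclusion. *)
Lemma tiling_sub_eq U V : is_tiling U -> is_tiling V -> U `<=` V -> U = V.
Proof.
move=> tU tV UV; apply/seteqP; split => // t Vt.
have [_ tileV oV _] := tV; have [z zt] := is_tile_interior (tileV t Vt).
have [t' Ut' zt'] := tiling_cover z tU.
by rewrite (overlap_eq oV Vt (UV _ Ut') (tileV _ (UV _ Ut')) zt zt').
Qed.

(** A ball around the puncture of [t] with radius just below the minimal inner radius lies in [t],
    so the puncture of [t'] would be interior to [t]. *)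
Lemma tile_separated (T : nat -> tileset R d L) n t t' :
  is_tiling (T n) -> 0 < min_radius T n -> T n t -> T n t' ->
  enorm (tile_punct t' - tile_punct t) < min_radius T n -> t = t'.
Proof.
move=> [_ tT oT _] r0 Tt Tt' tt'.
have [r1 tr1 r1n] : exists2 r, enorm (tile_punct t' - tile_punct t) < r &
    r < min_radius T n.
  by exists ((enorm (tile_punct t' - tile_punct t) + min_radius T n) / 2); lra.
apply: (@overlap_eq _ _ _ (tile_punct t') oT) => //; first exact: tT.
- have /nbhs_eball : enorm (tile_punct t' - tile_punct t) < r1 by [].
  apply: filterS; apply: eball_inner_radius.
    exact: le_trans (enorm_ge0 _) (ltW tr1).
  apply: lt_le_trans r1n _.
  by apply: ge_inf; [exists 0 => _ [s _ <-]; exact: inner_radius_ge0|exists t].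
- by have [] := tT _ Tt'.
Qed.

End Tiles.

(** * The tiling metric and the topology of the hull *)

Section TilingDist.
Variables (R : realType) (d : nat) (L : Type).
Implicit Types (T U V W : tileset R d L) (a : 'rV[R]_d) (e r s : R).

Lemma agree_on_le r s T U : s <= r -> agree_on r T U -> agree_on s T U.
Proof. by move=> sr TU t ts; apply: TU; exact: lt_le_trans sr. Qed.

Lemma agree_on_sym r T U : agree_on r T U -> agree_on r U T.
Proof. by move=> TU t /TU[]. Qed.

Lemma agree_on_trans r T U V : agree_on r T U -> agree_on r U V -> agree_on r T V.
Proof. by move=> TU UV t tr; apply: iff_trans (TU t tr) (UV t tr). Qed.

Lemma agree_on_shift r a T U : agree_on r T U ->
  agree_on (r - enorm a) (shift_tiles a T) (shift_tiles a U).
Proof.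
move=> TU t tr; rewrite !shift_tilesE /=; apply: TU => /=.
by apply: le_lt_trans (enormD _ _) _; rewrite enormN -ltrBrDr.
Qed.

Lemma tiling_dist_le e a a' T U : 0 < e -> e < 1 -> enorm a < e ->
  enorm a' < e -> agree_on e^-1 (shift_tiles a T) (shift_tiles a' U) ->
  tiling_dist T U <= e.
Proof.
move=> e0 e1 ae a'e TU; apply: ge_inf.
  by exists 0 => x [[/ltW]|->].
by left; split=> //; exists a, a'; rewrite /eball /= !subr0.
Qed.

Lemma agree_on_dist e T U : 0 < e -> e < 1 -> agree_on e^-1 T U ->
  tiling_dist T U <= e.
Proof.
move=> e0 e1 TU; apply: (@tiling_dist_le _ 0 0); rewrite ?enorm0 //.
by rewrite !shift_tiles0.
Qed.

Lemma tiling_dist_lt e T U : e <= 1 -> tiling_dist T U < e ->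
  exists s a a', [/\ 0 < s, s < e, enorm a < s, enorm a' < s &
    agree_on s^-1 (shift_tiles a T) (shift_tiles a' U)].
Proof.
move=> e1 TUe; have [|s [[s0 s1 [a [a' []]]]|->]] := inf_lt _ TUe; last first.
- by rewrite ltNge e1.
- by rewrite /eball /= !subr0 => ? ? ? ?; exists s, a, a'.
- by exists 1; right.
Qed.

(** Composing two approximate coincidences shrinks the ball of agreement by the length of a
    translation; the factor [3] leaves room for this loss. *)
Lemma tiling_dist_triangle e T U V : e <= 1 -> tiling_dist T U < e / 3 ->
  tiling_dist U V < e / 3 -> tiling_dist T V < e.
Proof.
move=> e1; have e3 : e / 3 <= 1 by lra.
move=> /(tiling_dist_lt e3)[s [a [a' [s0 se as_ a's TU]]]].
move=> /(tiling_dist_lt e3)[s' [b [b' [s'0 s'e bs b's UV]]]].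
(* Both scales may be replaced by their maximum, since agreement restricts to smaller balls. *)
wlog : s s' s0 s'0 se s'e as_ a's bs b's TU UV / s = s'.
  move=> h; pose m := Num.max s s'.
  have [sm s'm] : s <= m /\ s' <= m by rewrite !le_max !lexx orbT.
  have m0 : 0 < m by exact: lt_le_trans sm.
  apply: (h m m) => //; rewrite ?gt_max ?se ?s'e //;
    try (by apply: lt_le_trans; eauto).
  - by apply: agree_on_le TU; rewrite lef_pV2.
  - by apply: agree_on_le UV; rewrite lef_pV2.
move=> ss'; subst s'.
have s3e : 3 * s < e by lra.
(* Translating further by [b - a'] carries [U + a'] to [U + b], where the second coincidence takes
   over. *)
apply: le_lt_trans s3e; apply: (@tiling_dist_le _ (a + (b - a')) b');
  rewrite ?mulr_gt0 //; try lra.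
- have := enormD a (b - a'); have := enormD b (- a'); rewrite enormN; lra.
- rewrite -!shift_tilesD.
  apply: (@agree_on_trans _ _ (shift_tiles b U)); last first.
    by apply: agree_on_le UV; rewrite lef_pV2 ?posrE ?mulr_gt0 //; lra.
  have := agree_on_shift (a := b - a') TU; rewrite !shift_tilesD [a' + _]addrC subrK.
  apply: agree_on_le; have h := enormD b (- a'); rewrite enormN in h.
  (* The loss is at most [|b - a'| < 2 s], and the inequality holds because [s < 1 / 3]. *)
  have : (3 * s)^-1 <= s^-1 - 2 * s.
    rewrite invfM -subr_ge0.
    have -> : s^-1 - 2 * s - 3^-1 * s^-1 = s^-1 * (2 / 3 - 2 * s ^+ 2).
      by field; rewrite gt_eqF.
    by rewrite mulr_ge0 ?invr_ge0 ?(ltW s0) //; nra.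
  by lra.
Qed.

Lemma tiling_dist_refl e T : 0 < e -> tiling_dist T T < e.
Proof.
move=> e0; pose s := Num.min (e / 2) 2^-1.
have s0 : 0 < s by rewrite lt_min; apply/andP; split; lra.
apply: (@le_lt_trans _ _ s); last by rewrite gt_min; apply/orP; left; lra.
apply: agree_on_dist => //.
by rewrite gt_min; apply/orP; right; lra.
Qed.

(* The [e]-balls of [tiling_dist] need not be open; the points around which
   [tiling_dist] stays below [e] form an open set by the weak triangle
   inequality. *)
Lemma nbhs_tiling_dist e T : 0 < e -> nbhs T [set U | tiling_dist T U < e].
Proof.
move=> e0; rewrite nbhsE /=.
exists [set U | exists2 s, 0 < s & forall V, tiling_dist U V < s ->
  tiling_dist T V < e]; last first.
  by move=> U [s s0]; apply; exact: tiling_dist_refl.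
split; last by exists e.
move=> U [s s0 hs]; pose m := Num.min s 1.
have m0 : 0 < m by rewrite lt_min s0 ltr01.
exists (m / 3) => [|V UV]; first by rewrite divr_gt0.
exists (m / 3) => [|W VW]; first by rewrite divr_gt0.
 apply: hs; apply: (@lt_le_trans _ _ m); last first.
  by rewrite ge_min lexx.
by apply: tiling_dist_triangle UV VW; rewrite ge_min lexx orbT.
Qed.

Lemma tiling_nbhs_dist T (A : set (tileset R d L)) : nbhs T A ->
  exists2 e, 0 < e & forall U, tiling_dist T U < e -> A U.
Proof.
rewrite nbhsE => -[B [oB BT] BA]; have [e e0 he] := oB T BT.
by exists e => // U /he /BA.
Qed.

(** The small translation of [T] is moved to the side of [T1], at the cost of a slightly smaller
    ball. *)
Lemma hull_agree (T1 : tileset R d L) T r : hull T1 T ->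
  exists a, agree_on r T (shift_tiles a T1).
Proof.
(* Agreement at a scale below [1 / k] survives the translation back, which costs less than [1]. *)
move=> [_ clT]; pose k := `|r| + 2.
have k2 : 2 <= k by rewrite lerDr.
have k0 : 0 < k by exact: lt_le_trans k2.
have e0 : 0 < k^-1 by rewrite invr_gt0.
have [_ [[c ->]]] := clT _ (nbhs_tiling_dist T e0).
have k1 : k^-1 <= 1 by rewrite invf_le1 //; lra.
move=> /(tiling_dist_lt k1)[s [a [a' [s0 sk as_ a's /(agree_on_shift (a := - a))]]]].
rewrite !shift_tilesD subrr shift_tiles0 => h; eexists; apply: agree_on_le h.
have : k <= s^-1 by rewrite -[k]invrK lef_pV2 // ltW.
by have := ler_norm r; rewrite enormN /k; lra.
Qed.

End TilingDist.

(** * Supertiles, collars and their sizes *)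

Section Ancestors.
Variables (R : realType) (d : nat) (L : Type).
Variables (T : nat -> tileset R d L) (sigma : nat -> tile R d L -> tileset R d L).
Hypothesis hT : proper_nested_sequence T sigma.
Implicit Types (s t : tile R d L) (P : tileset R d L) (n : nat).

Local Notation rad n := (min_radius T n.+1).

Lemma level_tiling n : is_tiling (T n.+1).
Proof. exact: (ns_tiling (pns_nested hT)). Qed.

Lemma level_tile n t : T n.+1 t -> is_tile t.
Proof. by have [_ + _ _] := level_tiling n; apply. Qed.

Lemma level_nonoverlapping n : nonoverlapping (T n.+1).
Proof. by have [] := level_tiling n. Qed.

Lemma rad_gt0 n : 0 < rad n.
Proof. exact: (pns_radius hT). Qed.

(** Each level adds more than a fixed [rho], so [rad n] exceeds [n * rho]. The limiting arguments
    below rest on this. *)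
Lemma rad_unbounded (B : R) : exists N, forall n, (N <= n)%N -> B < rad n.
Proof.
have [rho rho0 hrho] := pns_growth hT.
have radS n : rad n + rho < rad n.+1 by have [] := hrho n.+1 isT.
have rad_lb n : n%:R * rho < rad n.
  elim: n => [|n IH]; first by rewrite mul0r rad_gt0.
  by apply: lt_trans (radS n); rewrite -natr1 mulrDl mul1r ltrD2r.
pose N := Num.Def.archi_bound `|B / rho|; exists N => n Nn.
have BN : B < N%:R * rho.
  rewrite -ltr_pdivrMr //; apply: le_lt_trans (ler_norm _) _.
  by apply: Num.Theory.archi_boundP.
apply: lt_trans (rad_lb n); apply: lt_le_trans BN _.
by rewrite ler_pM2r // ler_nat.
Qed.

Lemma rad_le m n : (m <= n)%N -> rad m <= rad n.
Proof.
have [rho rho0 hrho] := pns_growth hT.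
elim: n => [|n IH]; first by rewrite leqn0 => /eqP ->.
rewrite leq_eqVlt => /orP[/eqP -> //|]; rewrite ltnS => /IH mn.
have [h _] := hrho n.+1 isT; lra.
Qed.

Lemma sigma_sub n s t : T n.+2 t -> sigma n.+2 t s ->
  T n.+1 s /\ tile_supp s `<=` tile_supp t.
Proof.
move=> Tt ts; have [[_ sT] <-] := ns_patch (pns_nested hT) (ltn0Sn n) Tt.
by split; [exact: sT|move=> x sx; exists s].
Qed.

Lemma sigma_shift n t a : T n.+2 t ->
  sigma n.+2 (shift_tile a t) = shift_tiles a (sigma n.+2 t).
Proof. exact: (ns_shift (pns_nested hT)). Qed.

Lemma sigma_finite n t : T n.+2 t -> finite_set (sigma n.+2 t).
Proof. by move=> Tt; have [[[] ]] := ns_patch (pns_nested hT) (ltn0Sn n) Tt. Qed.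

(** A tile [t] of the next level covers an interior point of [s]; the tile of [sigma n.+2 t] through
    that point must be [s]. *)
Lemma parent_ex n s : T n.+1 s -> exists t, T n.+2 t /\ sigma n.+2 t s.
Proof.
move=> Ts; have [z zs] := is_tile_interior (level_tile Ts).
have [t Tt] := tiling_cover z (level_tiling n.+1).
have [[_ sT] sE] := ns_patch (pns_nested hT) (ltn0Sn n) Tt.
rewrite -sE => -[s' ts' zs']; exists t; split => //.
by rewrite (overlap_eq (level_nonoverlapping (n := n)) Ts (sT _ ts')
  (level_tile (sT _ ts')) zs zs').
Qed.

Lemma parent_uniq n s t t' : T n.+2 t -> T n.+2 t' ->
  sigma n.+2 t s -> sigma n.+2 t' s -> t = t'.
Proof.
move=> Tt Tt' ts t's.
have [Ts st] := sigma_sub Tt ts; have [_ st'] := sigma_sub Tt' t's.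
have [z zs] := is_tile_interior (level_tile Ts).
apply: (overlap_eq (level_nonoverlapping (n := n.+1)) Tt Tt' (level_tile Tt') (z := z)).
- exact: filterS st zs.
- exact: st' _ (interior_subset zs).
Qed.

(** The value [s] is a default for tiles outside [T n.+1]. *)
Definition parent n s : tile R d L :=
  if pselect (exists t, T n.+2 t /\ sigma n.+2 t s) is left e
  then sval (cid e) else s.

(** Levels are counted from [0] here: [ancestor n s] belongs to [T n.+1]. *)
Fixpoint ancestor n s : tile R d L :=
  if n is m.+1 then parent m (ancestor m s) else s.

Lemma parentP n s : T n.+1 s -> T n.+2 (parent n s) /\ sigma n.+2 (parent n s) s.
Proof.
by move=> /parent_ex e; rewrite /parent; case: pselect => // e'; case: cid.
Qed.

Lemma ancestor_in n s : T 1%N s -> T n.+1 (ancestor n s).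
Proof. by move=> Ts; elim: n => //= n /parentP[]. Qed.

Lemma ancestor_sigma n s : T 1%N s ->
  sigma n.+2 (ancestor n.+1 s) (ancestor n s).
Proof. by move=> /(ancestor_in n)/parentP[]. Qed.

Lemma ancestor_uniq n s t : T 1%N s -> T n.+2 t ->
  sigma n.+2 t (ancestor n s) -> ancestor n.+1 s = t.
Proof.
move=> Ts Tt ts.
by apply: (parent_uniq (ancestor_in _ Ts) Tt _ ts); exact: ancestor_sigma.
Qed.

Lemma ancestor_sub m n s : T 1%N s -> (m <= n)%N ->
  tile_supp (ancestor m s) `<=` tile_supp (ancestor n s).
Proof.
move=> Ts; elim: n => [|n IH]; first by rewrite leqn0 => /eqP ->.
rewrite leq_eqVlt => /orP[/eqP -> //|]; rewrite ltnS => /IH mn.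
apply: subset_trans mn _.
by have [] := sigma_sub (ancestor_in _ Ts) (ancestor_sigma n Ts).
Qed.

Lemma level_punct n t : T n.+1 t -> tile_supp t (tile_punct t).
Proof. by move=> /level_tile[]. Qed.

Lemma level_nonempty n t : T n.+1 t -> tile_supp t !=set0.
Proof. by move=> /level_punct; exists (tile_punct t). Qed.

Lemma ancestor_punct n s : T 1%N s ->
  tile_supp (ancestor n s) (tile_punct s).
Proof.
by move=> Ts; apply: (@ancestor_sub 0) => //; exact: level_punct Ts.
Qed.

(* When the outer radii are unbounded, [max_radius] is the junk value [0]; the
   growth condition excludes this at every level but the first, and tiles of a
   level are contained in tiles of the next one. *)
Lemma level_bounded n : exists2 D : R, 0 < D &
  forall t, T n.+1 t -> tile_supp t `<=` eball (tile_punct t) D.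
Proof.
have [rho rho0 hrho] := pns_growth hT; have [_ hM] := hrho n.+1 isT.
have max_ge0 m : 0 <= max_radius T m.
  rewrite /max_radius; set E := [set _ | _ in _].
  have [hs|/sup_out -> //] := pselect (has_sup E).
  have [[r Er] _] := hs; apply: le_trans (sup_upper_bound hs Er).
  by case: Er => t _ <-; exact: outer_radius_ge0.
have M0 : 0 < max_radius T n.+2.
  by apply: lt_trans hM; rewrite ltr_wpDl.
have Msup : has_sup [set outer_radius (tile_punct t) (tile_supp t) | t in T n.+2].
  apply: contrapT => /sup_out M0'.
  by move: M0; rewrite /max_radius M0' ltxx.
exists (2 * (max_radius T n.+2 + 1)) => [|s Ts x sx].
  by rewrite mulr_gt0 // ltr_wpDl.
have [t [Tt ts]] := parent_ex Ts; have [_ st] := sigma_sub Tt ts.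
have tM : tile_supp t `<=` eball (tile_punct t) (max_radius T n.+2 + 1).
  apply: sub_eball_outer_radius; first by case: (level_tile Tt).
  apply: (@le_lt_trans _ _ (max_radius T n.+2)); last by rewrite ltrDl.
  by apply: (sup_upper_bound Msup); exists t.
have := tM _ (st _ sx); have := tM _ (st _ (level_punct Ts)).
rewrite /eball /=; have := enorm_dist x (tile_punct t) (tile_punct s).
by rewrite (enormB (tile_punct t)); lra.
Qed.

Lemma level_locally_finite n (x : 'rV[R]_d) (B : R) :
  finite_set [set t | T n.+1 t /\ enorm (tile_punct t - x) <= B].
Proof.
apply: (@separated_finite _ _ _ _ (fun t => tile_punct t - x) _ B (rad_gt0 n)).
  by move=> t [].
move=> t t' [Tt _] [Tt' _]; rewrite opprB addrA subrK enormB => h.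
exact: tile_separated (level_tiling n) (rad_gt0 n) Tt Tt' h.
Qed.

Lemma collar_sub n t : collar T n.+1 t `<=` T n.+1.
Proof. by move=> t' []. Qed.

Lemma collar_self n t : T n.+1 t -> collar T n.+1 t t.
Proof.
move=> Tt; split => //; apply: le_trans (ltW (rad_gt0 n)).
have tp := level_punct Tt; apply: le_trans (euclid_dist_le tp tp) _.
by rewrite subrr enorm0.
Qed.

Lemma collar_bounded n : exists2 K : R, 0 < K &
  forall t, T n.+1 t -> patch_support (collar T n.+1 t) `<=` eball (tile_punct t) K.
Proof.
have [D D0 hD] := level_bounded n; have r0 := rad_gt0 n.
(* From [x] to the puncture of [t] via the puncture of [t'], then [z] and [y]: three steps within
   tiles and one gap below [rad n + 1]. *)
exists (D + D + D + rad n + 1) => [|t Tt x [t' [Tt' tt'] t'x]].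
  by rewrite !addr_gt0.
have [|||y [z [ty t'z yz]]] :=
    @euclid_dist_lt _ _ (tile_supp t) (tile_supp t') (rad n + 1).
- exact: level_nonempty Tt.
- exact: level_nonempty Tt'.
- by apply: le_lt_trans tt' _; rewrite ltrDl.
have := hD _ Tt _ ty; have := hD _ Tt' _ t'z; have := hD _ Tt' _ t'x.
rewrite /eball /=; have := enorm_dist x (tile_punct t') (tile_punct t).
have := enorm_dist (tile_punct t') z (tile_punct t).
have := enorm_dist z y (tile_punct t).
by rewrite (enormB _ z) (enormB z y); lra.
Qed.

Lemma collar_finite n t : T n.+1 t -> finite_set (collar T n.+1 t).
Proof.
move=> Tt; have [K _ hK] := collar_bounded n.
apply: sub_finite_set (level_locally_finite n (tile_punct t) K) => t' ct'.
split; first exact: collar_sub ct'.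
apply/ltW/(hK _ Tt); exists t' => //.
exact: level_punct (collar_sub ct').
Qed.

Lemma collar_patch_of n t : T n.+1 t -> patch_of (T n.+1) (collar T n.+1 t).
Proof.
move=> Tt; split; last exact: collar_sub.
split; first exact: collar_finite.
  by move=> t' /collar_sub/level_tile.
exact: nonoverlapping_sub (collar_sub (t := t)) (level_nonoverlapping (n := n)).
Qed.

(* The collar of a tile [s] of [sigma t] lies in [sigma (collar t)], because the
   radii increase with the level. *)
Lemma collar_shift n s t a : T n.+2 t -> T n.+2 (shift_tile a t) ->
  collar T n.+2 (shift_tile a t) = shift_tiles a (collar T n.+2 t) ->
  sigma n.+2 t s ->
  collar T n.+1 (shift_tile a s) = shift_tiles a (collar T n.+1 s).
Proof.
have H b u v : T n.+2 u -> T n.+2 (shift_tile b u) ->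
    collar T n.+2 (shift_tile b u) = shift_tiles b (collar T n.+2 u) ->
    sigma n.+2 u v ->
    shift_tiles b (collar T n.+1 v) `<=` collar T n.+1 (shift_tile b v).
  move=> Tu Tbu cbu uv _ [v' [Tv' vv'] <-].
  have [u' [Tu' u'v']] := parent_ex Tv'.
  have [Tv vu] := sigma_sub Tu uv; have [_ vu'] := sigma_sub Tu' u'v'.
  have cu' : collar T n.+2 u u'.
    split => //; apply: le_trans (rad_le (leqnSn n)); apply: le_trans vv'.
    apply: euclid_dist_sub => //; first exact: level_nonempty Tv.
    exact: level_nonempty Tv'.
  have Tbu' : T n.+2 (shift_tile b u').
    by apply: (@collar_sub n.+1 (shift_tile b u)); rewrite cbu; exists u'.
  have bv' : sigma n.+2 (shift_tile b u') (shift_tile b v').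
    by rewrite sigma_shift //; exists v'.
  split; first by have [] := sigma_sub Tbu' bv'.
  by rewrite euclid_dist_shift.
move=> Tt Tat cat ts; apply/seteqP; split; last exact: H Tt Tat cat ts.
have := @H (- a) (shift_tile a t) (shift_tile a s).
rewrite !shift_tileK => /(_ Tat Tt) h.
have {}h : shift_tiles (- a) (collar T n.+1 (shift_tile a s)) `<=` collar T n.+1 s.
  apply: h; first by rewrite cat shift_tilesD subrr shift_tiles0.
  by rewrite sigma_shift //; exists s.
move=> u cu; rewrite shift_tilesE /=; apply: h.
by exists u.
Qed.

(** By uniqueness of parents, membership in an iterated substitution becomes a condition on
    ancestors. *)
Lemma sigma_compE n P : P `<=` T n.+1 ->
  sigma_comp sigma n.+1 P = [set s | T 1%N s /\ P (ancestor n s)].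
Proof.
elim: n P => [|n IH] P PT.
  rewrite /=; apply/seteqP; split => s.
    move=> [t Pt]; rewrite (ns_sigma1 (pns_nested hT)) => ->.
    by split => //; exact: PT.
  by move=> [Ts Ps]; exists s => //; rewrite (ns_sigma1 (pns_nested hT)).
rewrite -[LHS]/(sigma_comp sigma n.+1 (\bigcup_(t in P) sigma n.+2 t)).
rewrite IH; last first.
  by move=> s [t Pt ts]; have [] := sigma_sub (PT _ Pt) ts.
apply/seteqP; split => s [Ts].
  by move=> [t Pt ts]; split => //; rewrite (ancestor_uniq Ts (PT _ Pt) ts).
by move=> Ps; split => //; exists (ancestor n.+1 s) => //; exact: ancestor_sigma.
Qed.

Definition collar_tiles n s : tileset R d L :=
  [set t | T 1%N t /\ collar T n.+1 (ancestor n s) (ancestor n t)].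

Lemma collar_tilesE n s :
  sigma_comp sigma n.+1 (collar T n.+1 (ancestor n s)) = collar_tiles n s.
Proof. by rewrite sigma_compE //; exact: collar_sub. Qed.

(** Passing to higher ancestors enlarges supports, hence shortens distances, while the collar radius
    grows. *)
Lemma collar_tiles_mono m n s : T 1%N s -> (m <= n)%N ->
  collar_tiles m s `<=` collar_tiles n s.
Proof.
move=> Ts mn t [Tt [_ st]]; split => //; split; first exact: ancestor_in.
apply: le_trans (rad_le mn); apply: le_trans st.
apply: euclid_dist_sub; try exact: ancestor_sub.
  exact: level_nonempty (ancestor_in m Ts).
exact: level_nonempty (ancestor_in m Tt).
Qed.

(** The ancestors contain the punctures of [s] and [t], so they are at least as close as these. With
    growing radii, the patches thus fill all of space. *)
Lemma collar_tiles_near n s t : T 1%N s -> T 1%N t ->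
  enorm (tile_punct t - tile_punct s) <= rad n -> collar_tiles n s t.
Proof.
move=> Ts Tt st; split=> //; split; first exact: ancestor_in.
have := euclid_dist_le (ancestor_punct n Ts) (ancestor_punct n Tt).
by rewrite enormB => /le_trans; apply.
Qed.

Lemma collar_tiles_bounded n : exists2 K : R, 0 < K & forall s t, T 1%N s ->
  collar_tiles n s t -> enorm (tile_punct t - tile_punct s) < K.
Proof.
have [D D0 hD] := level_bounded n; have [K K0 hK] := collar_bounded n.
exists (D + K) => [|s t Ts [Tt ct]]; first by rewrite addr_gt0.
have h : eball (tile_punct (ancestor n s)) K (tile_punct t).
  apply: hK; first exact: ancestor_in.
  by exists (ancestor n t) => //; exact: ancestor_punct.
have := hD _ (ancestor_in n Ts) _ (ancestor_punct n Ts); move: h.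
rewrite /eball /=.
have := enorm_dist (tile_punct t) (tile_punct (ancestor n s)) (tile_punct s).
by rewrite (enormB (tile_punct (ancestor n s))); lra.
Qed.

End Ancestors.

(** * Paths of the diagram and the tilings they define *)

Section Paths.
Variables (R : realType) (d : nat) (L : Type).
Variables (T : nat -> tileset R d L) (sigma : nat -> tile R d L -> tileset R d L).
Hypothesis hT : proper_nested_sequence T sigma.
Implicit Types (s t : tile R d L) (P : tileset R d L) (n : nat).
Implicit Types (x y : edge_sequence R d L).

Local Notation rad n := (min_radius T n.+1).
Local Notation anc := (ancestor T sigma).
Local Notation patch x n := (collar_patch sigma (mkseq x n.+1)).

(** Finite local complexity leaves finitely many collar patches up to translation; a vertex is such
    a patch with one of its tiles moved to the origin. *)
Lemma vertices_finite n : finite_set (vertices T n.+1).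
Proof.
have [K K0 hK] := collar_bounded hT n.
have K10 : 0 < K + 1 by rewrite addr_gt0.
have [F Ffin hF] := pns_flc hT (ltn0Sn n) K10.
apply: (@sub_finite_set _ _ (\bigcup_(q in [set q | F q /\ finite_set q])
    [set Some (shift_tile (- tile_punct s) s, shift_tiles (- tile_punct s) q)
    | s in q])); last first.
  apply: bigcup_finite; first by apply: sub_finite_set Ffin => q [].
  by move=> q [_ qfin]; exact: finite_image.
move=> _ [[t Q] [a [-> /= t0 [/= Tt cE]]]].
have [|||q Fq [b pE]] := hF (collar T n.+1 (shift_tile a t)) (shift_tile a t).
- exact: (collar_patch_of hT).
- exact: (collar_self hT).
- apply: (@le_lt_trans _ _ K); last by rewrite ltrDl.
  apply: outer_radius_le; first exact: ltW.
  by move=> y /(hK _ Tt)/ltW.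
have qE : q = shift_tiles (- b) (collar T n.+1 (shift_tile a t)).
  by rewrite pE shift_tilesD subrr shift_tiles0.
exists q.
  by split => //; rewrite qE; apply: finite_image; exact: (collar_finite hT).
exists (shift_tile (a - b) t).
  by rewrite qE shift_tilesE /= opprK shift_tileD subrK; exact: (collar_self hT).
rewrite /= t0 add0r shift_tileD subrr shift_tile0 qE cE !shift_tilesD.
by rewrite addrA subrr shift_tiles0.
Qed.

Lemma vertical_edges_finite n : finite_set (vertical_edges T sigma n.+1).
Proof.
case: n => [|n].
  apply: (@sub_finite_set _ _ ((fun v => Edge None v 0) @` vertices T 1%N)).
    by move=> [v w a] /= [-> wV ->]; exists w.
  exact/finite_image/vertices_finite.
apply: (@sub_finite_set _ _ (\bigcup_(v in vertices T n.+1)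
  \bigcup_(w in vertices T n.+2) [set e | vertical_edges T sigma n.+2 e /\
    esrc e = v /\ erng e = w])).
  by move=> e eE; have [vV wV _] := eE; exists (esrc e) => //; exists (erng e).
apply: bigcup_finite => [|v vV]; first exact: vertices_finite.
apply: bigcup_finite => [|w wV]; first exact: vertices_finite.
have [w' [c [{}wE _ [/= Tc _]]]] := wV; rewrite {w}wE in wV *.
(* With source and range fixed, the label is read off the puncture of a tile in one finite patch. *)
apply: (@sub_finite_set _ _ ((fun s => Edge v (Some w') (c - tile_punct s)) @`
  sigma n.+2 (shift_tile c w'.1))); last first.
  exact/finite_image/(sigma_finite hT).
move=> [v0 w0 l] /= [[[v1 [? [-> v10 _]]] _ [v2 [w2 [a [b [/= [<-] -> ->]]]]]]].
move=> [/= Tb _] [vs _] [<- [w2E]]; rewrite {w2}w2E in Tb vs *.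
exists (shift_tile (a + c) v1.1); last by rewrite /= v10 add0r opprD addrCA subrr addr0.
have -> : shift_tile c w'.1 = shift_tile (c - b) (shift_tile b w'.1).
  by rewrite shift_tileD addrC subrK.
rewrite (sigma_shift hT) //; exists (shift_tile (a + b) v1.1) => //.
by rewrite shift_tileD -addrA [b + _]addrC subrK.
Qed.

Definition prototile n s : ctile R d L :=
  (shift_tile (- tile_punct (anc n s)) (anc n s),
   shift_tiles (- tile_punct (anc n s)) (collar T n.+1 (anc n s))).

(** Labels are displacements between punctures of successive ancestors, so their sums telescope. *)
Definition tile_path s : edge_sequence R d L := fun n =>
  if n is m.+1 then Edge (Some (prototile m s)) (Some (prototile n s))
    (tile_punct (anc n s) - tile_punct (anc m s))
  else Edge None (Some (prototile 0 s)) 0.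

Lemma prototile_occurs n s : T 1%N s ->
  occurs T n.+1 (prototile n s) (tile_punct (anc n s)).
Proof.
move=> Ts; split; rewrite /= shift_tileD addNr shift_tile0.
  exact: ancestor_in.
by rewrite shift_tilesD addNr shift_tiles0.
Qed.

Lemma prototile_vertex n s : T 1%N s -> vertices T n.+1 (Some (prototile n s)).
Proof.
move=> Ts; exists (prototile n s), (tile_punct (anc n s)).
by split; rewrite /= ?subrr //; exact: prototile_occurs.
Qed.

Lemma tile_path_in s : T 1%N s -> path_space T sigma (tile_path s).
Proof.
move=> Ts n; split; last by case: n.
case: n => [|n]; first by split => //; exact: prototile_vertex.
split; try exact: prototile_vertex.
exists (prototile n s), (prototile n.+1 s).
exists (tile_punct (anc n s) - tile_punct (anc n.+1 s)), (tile_punct (anc n.+1 s)).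
rewrite opprB subrK; split=> //; first exact: prototile_occurs.
split; last exact: prototile_occurs.
by rewrite /prototile shift_tileD addNr shift_tile0 shift_tileD addNr shift_tile0;
  exact: ancestor_sigma.
Qed.

(** An occurrence of the last vertex determines, level by level, the subtiles selected by the edges,
    down to a tile [s] of [T 1]. *)
Lemma path_embeds x n w a : path_space T sigma x -> erng (x n) = Some w ->
  occurs T n.+1 w a ->
  exists s, [/\ T 1%N s, forall i, (i <= n)%N -> tile_path s i = x i &
    anc n s = shift_tile a w.1].
Proof.
move=> px; elim: n w a => [|n IH] w a xw [Tw cw].
  exists (shift_tile a w.1); split => // i; rewrite leqn0 => /eqP ->.
  have [[eN eV e0] _] := px 0%N.
  have [w' [b [wE w0 _]]] := eV; move: wE; rewrite xw => -[wE].
  rewrite -{w'}wE in w0; rewrite /tile_path /prototile /= w0 add0r.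
  case: (x 0%N) eN xw e0 => [v v' l] /= -> -> ->; congr (Edge _ (Some _) _).
  rewrite shift_tileD subrr shift_tile0 cw shift_tilesD subrr shift_tiles0.
  by case: (w).
have [[vV wV [v [w' [b [c [vE wE lE [Tc cc] [vs [Tv cv]]]]]]]] xS] := px n.+1.
move: wE; rewrite xw => -[wE]; rewrite -{w'}wE in Tc cc vs.
have waE : shift_tile a w.1 = shift_tile (a - c) (shift_tile c w.1).
  by rewrite shift_tileD addrC subrK.
have vaE : shift_tile (b + a) v.1 = shift_tile (a - c) (shift_tile (b + c) v.1).
  by rewrite shift_tileD -addrA [c + _]addrC subrK.
have vsa : sigma n.+2 (shift_tile a w.1) (shift_tile (b + a) v.1).
  by rewrite waE vaE (sigma_shift hT) //; exact: shift_tiles_mem.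
(* The collar of the subtile is carried along because the collar of [w] is the same at both
   occurrences. *)
have ov : occurs T n.+1 v (b + a).
  split; first by have [] := sigma_sub hT Tw vsa.
  rewrite vaE (collar_shift hT Tc _ _ vs) -?waE //.
    by rewrite cv shift_tilesD -addrA [c + _]addrC subrK.
  by rewrite cw cc shift_tilesD [c + _]addrC subrK.
have [|s [Ts sx sv]] := IH v (b + a) _ ov.
  by have [_ ->] := px n.
have sw : anc n.+1 s = shift_tile a w.1.
  by apply: (ancestor_uniq hT Ts Tw); rewrite sv.
exists s; split => // i; rewrite leq_eqVlt => /orP[/eqP ->|]; last exact: sx.
(* Vertices are punctured at the origin, so normalizing the ancestors of [s] gives back [v] and
   [w]. *)
have [v' [? [vE' v0 _]]] := vV; move: vE'; rewrite vE => -[vE'].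
rewrite -{v'}vE' in v0.
have [w' [? [wE' w0 _]]] := wV; move: wE'; rewrite xw => -[wE'].
rewrite -{w'}wE' in w0.
rewrite /tile_path /prototile sw sv /= v0 w0 !add0r.
case: (x n.+1) vE xw lE => [? ? ?] /= -> -> ->; congr (Edge (Some _) (Some _) _).
- rewrite shift_tileD subrr shift_tile0 ov.2 shift_tilesD subrr shift_tiles0.
  by case: (v).
- rewrite shift_tileD subrr shift_tile0 cw shift_tilesD subrr shift_tiles0.
  by case: (w).
- by rewrite opprD addrC subrK.
Qed.

Lemma path_vertex x n : path_space T sigma x -> vertices T n.+1 (erng (x n)).
Proof. by move=> /(_ n)[+ _]; case: n => [[]|n []]. Qed.

Lemma path_embeds_ex x n : path_space T sigma x ->
  exists2 s, T 1%N s & forall i, (i <= n)%N -> tile_path s i = x i.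
Proof.
move=> px; have [w [a [xw _ ow]]] := path_vertex n px.
by have [s [Ts sx _]] := path_embeds px xw ow; exists s.
Qed.

Lemma sigma_comp_shift n P a : P `<=` T n.+1 ->
  sigma_comp sigma n.+1 (shift_tiles a P) =
  shift_tiles a (sigma_comp sigma n.+1 P).
Proof.
have S1 t : sigma 1%N t = [set t] by rewrite (ns_sigma1 (pns_nested hT)).
have E Q : sigma_comp sigma 1%N Q = Q.
  apply/seteqP; split => s /=; first by move=> [t Qt]; rewrite S1 => ->.
  by move=> Qs; exists s => //; rewrite S1.
elim: n P => [|n IH] P PT; first by rewrite !E.
rewrite -[LHS]/(sigma_comp sigma n.+1
  (\bigcup_(t in shift_tiles a P) sigma n.+2 t)).
rewrite -[sigma_comp sigma n.+2 P]/(sigma_comp sigma n.+1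
  (\bigcup_(t in P) sigma n.+2 t)).
rewrite -IH; last first.
  by move=> s [t Pt ts]; have [] := sigma_sub hT (PT _ Pt) ts.
congr (sigma_comp _ _ _); apply/seteqP; split => s.
  move=> [_ [t Pt <-]]; rewrite (sigma_shift hT); last exact: PT.
  by move=> [s' ts' <-]; exists s' => //; exists t.
move=> [s' [t Pt ts'] <-]; exists (shift_tile a t); first by exists t.
by rewrite (sigma_shift hT); [exists s'|exact: PT].
Qed.

Lemma path_label_mkseq x n : path_label (mkseq x n) = \sum_(0 <= i < n) elab (x i).
Proof. by rewrite /path_label /mkseq big_map /index_iota subn0. Qed.

Lemma path_range_mkseq x n : path_range (mkseq x n.+1) = erng (x n).
Proof. by rewrite /path_range mkseqS map_rcons last_rcons. Qed.

Lemma tile_path_label s n :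
  path_label (mkseq (tile_path s) n.+1) = tile_punct (anc n s) - tile_punct s.
Proof.
rewrite path_label_mkseq; elim: n => [|n IH].
  by rewrite big_nat1 /= subrr.
by rewrite big_nat_recr //= IH addrC addrA subrK.
Qed.

Lemma mkseq_agree x y n : (forall i, (i <= n)%N -> x i = y i) ->
  mkseq x n.+1 = mkseq y n.+1.
Proof.
move=> xy; apply/eq_in_map => i; rewrite mem_iota add0n ltnS => /andP[_].
exact: xy.
Qed.

(** The telescoped label cancels the normalization of the prototile and leaves the translation
    moving [s] to the origin. *)
Lemma collar_patch_tile x n s : T 1%N s ->
  (forall i, (i <= n)%N -> tile_path s i = x i) ->
  patch x n = shift_tiles (- tile_punct s) (collar_tiles T sigma n s).
Proof.
move=> Ts /mkseq_agree <-.
rewrite /collar_patch tile_path_label size_mkseq path_range_mkseq.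
have -> : erng (tile_path s n) = Some (prototile n s) by case: (n).
rewrite sigma_comp_shift; last exact: collar_sub.
by rewrite (collar_tilesE hT) shift_tilesD addrA addNr add0r.
Qed.

(** An explicit form of [T_x], replacing the choice made in [path_tiling]. *)
Definition path_union x : tileset R d L := \bigcup_n patch x n.

Lemma patch_mono x m n : path_space T sigma x -> (m <= n)%N ->
  patch x m `<=` patch x n.
Proof.
move=> px mn; have [s Ts sx] := path_embeds_ex n px.
rewrite (collar_patch_tile Ts sx) (@collar_patch_tile x m s) //; last first.
  by move=> i im; apply: sx; exact: leq_trans mn.
by apply: shift_tilesS; exact: collar_tiles_mono.
Qed.

(** A prefix long enough to contain [t] is realized around a tile of [T 1], where nearby tiles
    already belong to the patch of level [n]. *)
Lemma path_union_near x n t : path_space T sigma x -> path_union x t ->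
  enorm (tile_punct t) <= rad n -> patch x n t.
Proof.
move=> px [m _ mt] tn.
have {}mt : patch x (maxn m n) t by apply: patch_mono mt => //; exact: leq_maxl.
have [s Ts sx] := path_embeds_ex (maxn m n) px.
move: mt; rewrite (collar_patch_tile Ts sx) (@collar_patch_tile x n s) //; last first.
  by move=> i im; apply: sx; apply: leq_trans im _; exact: leq_maxr.
rewrite !shift_tilesE /= opprK => -[Tt _].
by apply: collar_tiles_near => //=; rewrite addrK.
Qed.

(** Within radius [rad n] of the origin, the patch of level [n] is the whole tiling, both for the
    path and for [T 1] seen from [s]. *)
Lemma path_union_agree x n s : path_space T sigma x -> T 1%N s ->
  (forall i, (i <= n)%N -> tile_path s i = x i) ->
  agree_on (rad n) (path_union x) (shift_tiles (- tile_punct s) (T 1%N)).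
Proof.
move=> px Ts sx t /ltW tn; split.
  move=> /(path_union_near px)/(_ tn); rewrite (collar_patch_tile Ts sx).
  by apply: shift_tilesS => u [].
rewrite shift_tilesE /= opprK => Tt; exists n => //.
rewrite (collar_patch_tile Ts sx) shift_tilesE /= opprK.
by apply: collar_tiles_near => //=; rewrite addrK.
Qed.

Lemma path_union_approx x (r : R) : path_space T sigma x ->
  exists2 s, T 1%N s &
    agree_on r (path_union x) (shift_tiles (- tile_punct s) (T 1%N)).
Proof.
move=> px; have [N hN] := rad_unbounded hT r.
have [s Ts sx] := path_embeds_ex N px; exists s => //.
apply: agree_on_le (path_union_agree px Ts sx).
exact/ltW/hN.
Qed.

Lemma tiling_shift1 a : is_tiling (shift_tiles a (T 1%N)).
Proof. exact/is_tiling_shift/(level_tiling hT 0). Qed.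

(** Overlap and covering are local properties, inherited from translates of [T 1] that agree with
    the union on large balls. *)
Lemma path_union_tiling x : path_space T sigma x -> is_tiling (path_union x).
Proof.
move=> px; split.
- apply: bigcup_countable => // n _; have [s Ts sx] := path_embeds_ex n px.
  rewrite (collar_patch_tile Ts sx).
  have [cT _ _ _] := tiling_shift1 (- tile_punct s).
  by apply: sub_countable cT; apply: subset_card_le; apply: shift_tilesS => u [].
- move=> t [n _]; have [s Ts sx] := path_embeds_ex n px.
  rewrite (collar_patch_tile Ts sx) => -[u [Tu _] <-].
  exact/is_tile_shift/(level_tile hT (n := 0)).
- move=> t t' xt xt' tt'.
  have [s Ts st] := path_union_approx
    (enorm (tile_punct t) + enorm (tile_punct t') + 1) px.
  have [_ _ oT _] := tiling_shift1 (- tile_punct s).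
  have := enorm_ge0 (tile_punct t); have := enorm_ge0 (tile_punct t') => t0 t'0.
  by apply: oT => //; apply/st => //; lra.
- apply/seteqP; split => // y _; have [D D0 hD] := level_bounded hT 0.
  (* Tiles through [y] have their puncture within [D] of it. *)
  have [s Ts st] := path_union_approx (enorm y + D) px.
  have [t tT ty] := tiling_cover y (tiling_shift1 (- tile_punct s)).
  exists t => //; apply/st => //.
  have ys : tile_supp (shift_tile (tile_punct s) t) (y + tile_punct s) by exists y.
  move: tT; rewrite shift_tilesE /= opprK => /hD/(_ _ ys).
  rewrite /eball /= opprD addrACA subrr addr0 => yt.
  have := enorm_dist (tile_punct t) y 0; rewrite !subr0.
  by rewrite (enormB _ y); lra.
Qed.

Lemma path_union_transversal x : path_space T sigma x ->
  canonical_transversal (T 1%N) (path_union x).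
Proof.
move=> px; split; last first.
  have [s Ts sx] := path_embeds_ex 0 px.
  exists (shift_tile (- tile_punct s) s); last by rewrite /= subrr.
  exists 0%N => //; rewrite (collar_patch_tile Ts sx); exists s => //.
  by apply: collar_tiles_near => //; rewrite subrr enorm0 ltW // (rad_gt0 hT).
split; first exact: path_union_tiling.
move=> B /tiling_nbhs_dist[e e0 eB].
(* The bound [e / 2] makes the final inequality strict; the bound [1 / 2] keeps the scale below [1],
   as [tiling_dist] demands. *)
pose f := Num.min (e / 2) 2^-1.
have f0 : 0 < f by rewrite lt_min; apply/andP; split; lra.
have [s Ts st] := path_union_approx f^-1 px.
exists (shift_tiles (- tile_punct s) (T 1%N)); split; first by exists (- tile_punct s).
apply: eB; apply: (@le_lt_trans _ _ f).
  by apply: agree_on_dist => //; rewrite gt_min; apply/orP; right; lra.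
by rewrite gt_min; apply/orP; left; lra.
Qed.

(** Any tiling in the intersection contains the union of the patches, which is itself a tiling. *)
Lemma path_tilingE (x : path_space T sigma) : path_tiling x = path_union (val x).
Proof.
have px : path_space T sigma (val x) by exact: set_mem (valP x).
apply: xget_unique => [n /= n0|T'].
  split; first exact: path_union_transversal.
  by case: n n0 => // n _ t xt; exists n.
move=> hT'; apply/esym/tiling_sub_eq.
- exact: path_union_tiling.
- by have [[[]]] := hT' 1%N isT.
- by move=> t [n _ xt]; have [_] := hT' n.+1 isT; apply.
Qed.

End Paths.

(** * Topology and compactness of sequences of edges *)

Section PathTopology.
Variables (R : realType) (d : nat) (L : Type).
Implicit Types (x y : edge_sequence R d L) (n : nat).

Lemma edge_sequence_cvg (F : set_system (edge_sequence R d L)) x : Filter F ->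
  (forall n, F [set y | y n = x n]) -> F --> x.
Proof.
move=> FF Fx; apply/cvg_sup => i U [V [[W oW <-] Wx WU]].
by apply: filterS (Fx i) => y yx; apply: WU; rewrite /= yx.
Qed.

Lemma nbhs_prefix x n : nbhs x [set y | forall i, (i <= n)%N -> y i = x i].
Proof.
have coord m : nbhs x [set y | y m = x m].
  have := @proj_continuous nat
    (fun=> discrete_topology (edge R d L)) m x [set x m].
  by apply; exact: discrete_set1.
elim: n => [|n IH].
  by apply: filterS (coord 0%N) => y yx i; rewrite leqn0 => /eqP ->.
apply: filterS (filterI IH (coord n.+1)) => y [yx yn] i.
by rewrite leq_eqVlt => /orP[/eqP -> //|]; exact: yx.
Qed.

(** By Tychonoff, the sequence has a cluster point; every prefix of it is shared by terms of
    arbitrarily large index. *)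
Lemma compact_sequences (E : nat -> set (edge R d L)) :
  (forall n, finite_set (E n)) -> forall z : nat -> edge_sequence R d L,
  (forall k n, E n (z k n)) ->
  exists y, forall n K, exists2 k, (K <= k)%N &
    forall i, (i <= n)%N -> z k i = y i.
Proof.
move=> Efin z zE.
have cE : compact [set x : edge_sequence R d L | forall n, E n (x n)].
  apply: (@tychonoff nat (fun=> discrete_topology (edge R d L)) E) => n.
  exact: finite_compact.
have FE : (z @ \oo) [set x : edge_sequence R d L | forall n, E n (x n)].
  by exists 0%N => // k _ n; exact: zE.
have [y [_ cy]] := cE (z @ \oo) _ FE.
exists y => n K; have [|_ [[k /= Kk <-] zy]] :=
    cy (z @` [set k | (K <= k)%N]) _ _ (nbhs_prefix y n).
  by exists K => // k /= Kk; exists k.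
by exists k.
Qed.

End PathTopology.

(** * Limits of paths, surjectivity and aperiodicity *)

Section PathTilings.
Variables (R : realType) (d : nat) (L : Type).
Variables (T : nat -> tileset R d L) (sigma : nat -> tile R d L -> tileset R d L).
Hypothesis hT : proper_nested_sequence T sigma.
Implicit Types (s t : tile R d L) (n : nat) (c : 'rV[R]_d).
Implicit Types (x y : edge_sequence R d L) (U : tileset R d L).

Local Notation rad n := (min_radius T n.+1).
Local Notation patch x n := (collar_patch sigma (mkseq x n.+1)).
Local Notation tpath := (tile_path T sigma).
Local Notation union := (path_union sigma).
Local Notation is_path := (path_space T sigma).

Lemma patch_bounded x n : is_path x ->
  exists B : R, forall t, patch x n t -> enorm (tile_punct t) <= B.
Proof.
move=> px; have [K K0 hK] := collar_tiles_bounded hT n.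
have [s Ts sx] := path_embeds_ex hT n px.
exists K => t; rewrite (collar_patch_tile hT Ts sx) => -[u cu <-].
exact/ltW/(hK _ _ Ts cu).
Qed.

(** Each patch of a cluster point [y] is bounded and shared with some late [z k], so its tiles lie
    in [U]; an inclusion of tilings is an equality. *)
Lemma path_union_cluster (z : nat -> edge_sequence R d L) U :
  (forall k, is_path (z k)) -> is_tiling U ->
  (forall B : R, exists K, forall k, (K <= k)%N ->
     forall t, union (z k) t -> enorm (tile_punct t) <= B -> U t) ->
  exists y, [/\ is_path y, union y = U &
    forall n K, exists2 k, (K <= k)%N & forall i, (i <= n)%N -> z k i = y i].
Proof.
move=> pz tU zU.
have [|k n|y hy] := @compact_sequences _ _ _
    (fun n => vertical_edges T sigma n.+1) _ z.
- exact: vertical_edges_finite hT.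
- by have [] := pz k n.
have py : is_path y.
  move=> n; have [k _ zy] := hy n.+1 0%N.
  by rewrite -!zy //; exact: pz.
exists y; split => //; apply: tiling_sub_eq => //.
  exact: (path_union_tiling hT).
move=> t [n _ yt]; have [B hB] := patch_bounded n py.
have [K hK] := zU B; have [k Kk zy] := hy n K.
apply: (hK k Kk t _ (hB t yt)); exists n => //.
by rewrite (mkseq_agree zy).
Qed.

Lemma path_union_tile s : T 1%N s ->
  union (tpath s) = shift_tiles (- tile_punct s) (T 1%N).
Proof.
move=> Ts; have ps := tile_path_in hT Ts.
apply: tiling_sub_eq; first exact: (path_union_tiling hT).
  exact: (tiling_shift1 hT).
move=> t [n _]; rewrite (collar_patch_tile hT Ts) //.
by apply: shift_tilesS => u [].
Qed.

Lemma path_union_surj U : canonical_transversal (T 1%N) U ->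
  exists2 x, is_path x & union x = U.
Proof.
move=> [hU [t0 Ut0 t00]].
have /choice[c hc] : forall k : nat,
    exists a, agree_on k.+1%:R U (shift_tiles a (T 1%N)).
  by move=> k; exact: hull_agree.
(* The tile of [T 1] matching the origin tile [t0] of [U] in the [k]-th approximation. *)
pose s k := shift_tile (- c k) t0.
have Ts k : T 1%N (s k).
  have : shift_tiles (c k) (T 1%N) t0 by apply/(hc k); rewrite ?t00 ?enorm0.
  by rewrite shift_tilesE.
have zE k : union (tpath (s k)) = shift_tiles (c k) (T 1%N).
  by rewrite path_union_tile //= t00 add0r opprK.
have [|||x [px xU _]] := @path_union_cluster (fun k => tpath (s k)) U.
- by move=> k; exact: (tile_path_in hT).
- by have [] := hU.
- move=> B; exists (Num.bound `|B|) => k Bk t; rewrite zE => kt tB.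
  apply/(hc k) => //; apply: (le_lt_trans tB); apply: (le_lt_trans (ler_norm _)).
  apply: (@lt_le_trans _ _ (Num.bound `|B|)%:R).
    by apply: Num.Theory.archi_boundP.
  by rewrite ler_nat leqW.
by exists x.
Qed.

Lemma path_union_separated x t t' : is_path x -> union x t -> union x t' ->
  enorm (tile_punct t' - tile_punct t) < rad 0 -> t = t'.
Proof.
move=> px xt xt' tt'; pose B := enorm (tile_punct t) + enorm (tile_punct t') + 1.
have [s Ts st] := path_union_approx hT B px.
have Bt : enorm (tile_punct t) < B.
  by rewrite /B; have := enorm_ge0 (tile_punct t'); lra.
have Bt' : enorm (tile_punct t') < B.
  by rewrite /B; have := enorm_ge0 (tile_punct t); lra.
have /st := xt => /(_ Bt); have /st := xt' => /(_ Bt').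
rewrite shift_tilesE /= opprK => Tt' Tt.
apply: (@shift_tile_inj _ _ _ (tile_punct s)).
apply: (tile_separated (level_tiling hT 0) (rad_gt0 hT 0)) => //=.
by rewrite opprD addrACA subrr addr0.
Qed.

Lemma path_union_origin x : is_path x ->
  exists2 t, union x t & tile_punct t = 0.
Proof. by move=> /(path_union_transversal hT)[]. Qed.

(** Both tilings have a tile punctured at the origin; separation of punctures forces the two small
    translations to coincide, and they can be undone. *)
Lemma path_union_dist x y (e : R) : is_path x -> is_path y -> e <= 1 ->
  e + e <= rad 0 -> tiling_dist (union x) (union y) < e ->
  agree_on (e^-1 - 1) (union x) (union y).
Proof.
move=> px py e1 er /(tiling_dist_lt e1)[s [a [a' [s0 se as_ a's xy]]]].
have [t xt t0] := path_union_origin px; have [t' yt' t'0] := path_union_origin py.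
have s1 : 1 < s^-1 by rewrite invf_gt1 //; lra.
have : shift_tiles a (union x) (shift_tile a' t').
  by apply/xy; rewrite /= ?t'0 ?add0r; [lra|exact: shift_tiles_mem].
rewrite shift_tilesE /= shift_tileD => xt'.
have tt' : t = shift_tile (a' - a) t'.
  apply: path_union_separated px xt xt' _.
  rewrite /= t'0 t0 add0r subr0.
  by have := enormD a' (- a); rewrite enormN; lra.
have aa' : a' = a.
  apply/eqP; rewrite -subr_eq0; apply/eqP.
  by have := congr1 (@tile_punct _ _ _) tt'; rewrite /= t0 t'0 add0r.
move: xy; rewrite aa' => /(agree_on_shift (a := - a)).
rewrite !shift_tilesD subrr !shift_tiles0 enormN; apply: agree_on_le.
have : e^-1 <= s^-1 by rewrite lef_pV2 ?posrE //; lra.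
by lra.
Qed.

(* Patches recur at bounded distance from every point of the tilings in the
   hull, so a period of one of them is a period of [T 1]. *)
Lemma path_union_aperiodic x c : is_path x ->
  union x = shift_tiles c (union x) -> c = 0.
Proof.
move=> px xc; apply: contrapT => /(pns_aperiodic hT (ltn0Sn 0)); apply.
apply: tiling_sub_eq (tiling_shift1 hT c) (level_tiling hT 0) _.
move=> _ [t Tt <-]; have [D D0 hD] := level_bounded hT 0.
(* The radius is large enough for [p] to contain every tile of [T 1] meeting [t + c]. *)
pose p : tileset R d L :=
  [set u | T 1%N u /\ enorm (tile_punct u - tile_punct t) <= D + D + enorm c].
have pp : patch_of (T 1%N) p.
  split; last by move=> u [].
  split; first exact: (level_locally_finite hT).
    by move=> u [/(level_tile hT (n := 0))].
  by apply: nonoverlapping_sub (level_nonoverlapping hT (n := 0)) => u [].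
have [rho rho0 hrho] := pns_repetitive hT (ltn0Sn 0) pp.
have [n hn] := rad_unbounded hT (rho + enorm c); have {}hn := hn n (leqnn n).
have [s Ts sx] := path_embeds_ex hT n px.
have xs := path_union_agree hT px Ts sx.
(* A copy of [p] lies so near [s] that [T 1] and the tiling of [x] agree there, even after the
   translation by [c]. *)
have [a [pT pB]] := hrho (tile_punct s).
have c0 := enorm_ge0 c.
have pt : p t by split => //; rewrite subrr enorm0; lra.
have Tat : T 1%N (shift_tile a t) by apply: pT; exact: shift_tiles_mem.
have tas : enorm (tile_punct t + a - tile_punct s) < rho.
  apply: (pB (tile_punct t + a)); exists (shift_tile a t).
    exact: shift_tiles_mem.
  exact: (level_punct hT (n := 0) Tat).
have xat : union x (shift_tile (- tile_punct s) (shift_tile a t)).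
  by apply/xs; [rewrite /=; lra|exact: shift_tiles_mem].
have {xat} : union x (shift_tile (a + (- tile_punct s + c)) t).
  by rewrite xc -!shift_tileD; exact: shift_tiles_mem.
move=> /xs; rewrite shift_tilesE /= opprK shift_tileD.
have -> : a + (- tile_punct s + c) + tile_punct s = c + a.
  by rewrite addrC !addrA [tile_punct s + a]addrC addrK addrC.
rewrite -shift_tileD => Tact.
have {}Tact : T 1%N (shift_tile a (shift_tile c t)).
  apply: Tact; rewrite !addrA; apply: le_lt_trans (enormD _ _) _.
  by apply: lt_trans hn; rewrite ltrD2r.
have [z zt] := is_tile_interior (is_tile_shift c (level_tile hT (n := 0) Tt)).
have [u Tu uz] := tiling_cover z (level_tiling hT 0).
have pu : p u.
  split => //; have := hD _ Tu _ uz.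
  have [z' /(hD _ Tt) + zE] := interior_subset zt.
  have -> : z' = z - c by rewrite -zE addrK.
  rewrite /eball /=; have := enorm_dist (tile_punct u) z (tile_punct t).
  have := enorm_dist z (z - c) (tile_punct t).
  by rewrite subKr (enormB _ z); lra.
suff <- : u = shift_tile c t by [].
apply: (@shift_tile_inj _ _ _ a); apply/esym.
apply: (@overlap_eq _ _ _ _ _ _ (z + a) (level_nonoverlapping hT (n := 0))) => //.
- by apply: pT; exact: shift_tiles_mem.
- by apply: is_tile_shift; exact: (level_tile hT (n := 0)).
- by rewrite [tile_supp (shift_tile a _)]/= shift_set_interior; exists z.
- by exists z.
Qed.

End PathTilings.

(** * Path equivalence as a relative position inside [T 1] *)

Section OrbitEquivalence.
Variables (R : realType) (d : nat) (L : Type).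
Variables (T : nat -> tileset R d L) (sigma : nat -> tile R d L -> tileset R d L).
Hypothesis hT : proper_nested_sequence T sigma.
Implicit Types (s t : tile R d L) (n : nat) (c : 'rV[R]_d).
Implicit Types (x y : edge_sequence R d L) (U : tileset R d L).

Local Notation rad n := (min_radius T n.+1).
Local Notation anc := (ancestor T sigma).
Local Notation tpath := (tile_path T sigma).
Local Notation union := (path_union sigma).
Local Notation is_path := (path_space T sigma).
Local Notation label x n := (path_label (mkseq x n)).

(** The trace at level [n] of [T_y = T_x + c]: seen from [s], the origin [s'] of the second prefix
    is at [- c]. *)
Definition linked c x y n := exists s s', [/\ T 1%N s, T 1%N s',
  forall i, (i <= n)%N -> tpath s i = x i,
  forall i, (i <= n)%N -> tpath s' i = y i &
  tile_punct s' = tile_punct s - c].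

Lemma linked_shift c x y N : is_path x -> is_path y ->
  (forall n, (N <= n)%N -> linked c x y n) -> union y = shift_tiles c (union x).
Proof.
move=> px py xy; apply/esym/tiling_sub_eq.
- exact/is_tiling_shift/(path_union_tiling hT px).
- exact: (path_union_tiling hT).
move=> _ [t xt <-].
have [m hm] := rad_unbounded hT (enorm (tile_punct t) + enorm c).
have {}hm := hm (maxn N m) (leq_maxr _ _).
have [s [s' [Ts Ts' sx sy ss']]] := xy (maxn N m) (leq_maxl _ _).
have h := enormD (tile_punct t) c; have c0 := enorm_ge0 c.
apply/(path_union_agree hT py Ts' sy); first by rewrite /=; lra.
rewrite ss' opprB addrC -shift_tilesD; apply: shift_tiles_mem.
by apply/(path_union_agree hT px Ts sx) => //; lra.
Qed.

Lemma labelS x n : label x n.+1 = label x n + elab (x n).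
Proof. by rewrite !path_label_mkseq big_nat_recr. Qed.

Lemma label_tile x n s : (forall i, (i <= n)%N -> tpath s i = x i) ->
  label x n.+1 = tile_punct (anc n s) - tile_punct s.
Proof. by move=> /mkseq_agree <-; exact: tile_path_label. Qed.

(** The ancestors of [s] and [s'] contain punctures at distance [|c|], so each lies in the collar of
    the other; the label is the difference of their punctures. *)
Lemma linked_horizontal c x y n : linked c x y n -> enorm c <= rad n ->
  horizontal_edges T n.+1
    (Edge (erng (x n)) (erng (y n)) (label y n.+1 - label x n.+1 - c)).
Proof.
move=> [s [s' [Ts Ts' sx sy ss']]] cn.
have rngE u : erng (tpath u n) = Some (prototile T sigma n u) by case: (n).
have ps u : shift_tile (tile_punct (anc n u)) (prototile T sigma n u).1 = anc n u.
  by rewrite /= shift_tileD addNr shift_tile0.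
rewrite (label_tile sx) (label_tile sy) -sx // -sy // !rngE.
split; try exact: (prototile_vertex hT).
exists (prototile T sigma n s), (prototile T sigma n s').
exists (tile_punct (anc n s)), (tile_punct (anc n s')).
rewrite !ps; split=> //.
- by rewrite [elab _]/= ss'; apply/rowP => i; rewrite !mxE; ring.
- by split; exact: (prototile_occurs hT).
- split; first exact: (ancestor_in hT).
  apply: le_trans (euclid_dist_le (ancestor_punct hT n Ts') (ancestor_punct hT n Ts)) _.
  by rewrite ss' addrC addKr enormN.
- split; first exact: (ancestor_in hT).
  apply: le_trans (euclid_dist_le (ancestor_punct hT n Ts) (ancestor_punct hT n Ts')) _.
  by rewrite ss' subKr.
Qed.

(** Both prefixes are embedded at the two occurrences joined by [h]; their relative position is
    recovered from the labels. *)
Lemma horizontal_linked x y n h : is_path x -> is_path y ->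
  horizontal_edges T n.+1 h -> esrc h = erng (x n) -> erng h = erng (y n) ->
  linked (label y n.+1 - label x n.+1 - elab h) x y n.
Proof.
move=> px py [hV hW [v [w [a [a' [[hv hw] hl [ov ow] _ _]]]]]] hx hy.
have [s [Ts sx sv]] : exists s, [/\ T 1%N s,
    forall i, (i <= n)%N -> tpath s i = x i & anc n s = shift_tile a v.1].
  by apply: (path_embeds hT px _ ov); rewrite -hx.
have [s' [Ts' sy sw]] : exists s, [/\ T 1%N s,
    forall i, (i <= n)%N -> tpath s i = y i & anc n s = shift_tile a' w.1].
  by apply: (path_embeds hT py _ ow); rewrite -hy.
exists s, s'; split => //.
have v0 : tile_punct v.1 = 0 by have [? [? []]] := hV; rewrite hv => -[->].
have w0 : tile_punct w.1 = 0 by have [? [? []]] := hW; rewrite hw => -[->].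
rewrite (label_tile sx) (label_tile sy) sv sw hl /= v0 w0 !add0r.
by apply/rowP => i; rewrite !mxE; ring.
Qed.

Lemma path_equiv_linked (x y : is_path) : path_equiv x y ->
  exists N c, forall n, (N <= n)%N -> linked c (val x) (val y) n.
Proof.
have px : is_path (val x) by exact: set_mem (valP x).
have py : is_path (val y) by exact: set_mem (valP y).
move=> [N [h [hor com]]].
pose c n := label (val y) n.+1 - label (val x) n.+1 - elab (h n.+1).
(* Commutativity of the diagrams says precisely that the relative position does not depend on the
   level. *)
have cS n : (N <= n)%N -> c n.+1 = c n.
  move=> Nn; have [|_ _ _ _ /=] := com n.+2; first by rewrite ltnS leqW.
  move=> lab; rewrite /c !(labelS _ n.+1).
  have -> : elab (h n.+2) =
      elab (h n.+1) + elab (val y n.+1) - elab (val x n.+1).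
    by rewrite -lab [_ + elab (h _)]addrC addrK.
  by apply/rowP => i; rewrite !mxE; ring.
have cE n : (N <= n)%N -> c n = c N.
  elim: n => [|n IH]; first by rewrite leqn0 => /eqP ->.
  by rewrite leq_eqVlt => /orP[/eqP -> //|]; rewrite ltnS => Nn; rewrite cS // IH.
exists N, (c N) => n Nn; rewrite -(cE n Nn).
have [|_ _ hx hy _] := com n.+1; first by [].
apply: horizontal_linked => //; by [apply: hor; exact: leqW|].
Qed.

Lemma linked_path_equiv (x y : is_path) c :
  (forall n, linked c (val x) (val y) n) -> path_equiv x y.
Proof.
move=> xy; have [N hN] := rad_unbounded hT (enorm c).
have px : is_path (val x) by exact: set_mem (valP x).
have py : is_path (val y) by exact: set_mem (valP y).
(* Terms of a path are indexed from [0], so the vertex at level [n] is the range of term [n.-1];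
   starting at [N.+1] avoids the root. *)
exists N.+1, (fun n => Edge (erng (val x n.-1)) (erng (val y n.-1))
  (label (val y) n - label (val x) n - c)); split => [[//|n] Nn|[//|[//|n]] Nn].
  by apply: linked_horizontal => //; exact/ltW/hN.
split => //=; try by [have [_ ->] := px n|have [_ ->] := py n].
by rewrite !(labelS _ n.+1); apply/rowP => i; rewrite !mxE; ring.
Qed.

End OrbitEquivalence.

(** * The homeomorphism from paths to the transversal *)

Section Groupoids.
Variables (R : realType) (d : nat) (L : Type).
Variables (T : nat -> tileset R d L) (sigma : nat -> tile R d L -> tileset R d L).
Hypothesis hT : proper_nested_sequence T sigma.
Hypothesis hphi : injective (@path_tiling R d L T sigma).

Local Notation rad n := (min_radius T n.+1).
Local Notation tpath := (tile_path T sigma).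
Local Notation union := (path_union sigma).
Local Notation is_path := (path_space T sigma).
Local Notation phi := (@path_tiling R d L T sigma).
Local Notation Xi := (canonical_transversal (T 1%N)).
Implicit Types (x y : is_path) (c : 'rV[R]_d).

Let pathP x : is_path (val x). Proof. exact: set_mem (valP x). Qed.

Lemma path_tiling_transversal x : Xi (phi x).
Proof. by rewrite (path_tilingE hT); exact: (path_union_transversal hT). Qed.

Lemma path_tiling_surj U : Xi U -> exists x, phi x = U.
Proof.
move=> /(path_union_surj hT)[x px xU].
by exists (exist _ x (mem_set px)); rewrite (path_tilingE hT).
Qed.

(* The tile of [phi x] corresponding to the origin of [phi y] has an ancestor at
   every level of the hierarchy of [x]; by injectivity of [phi], the path so
   obtained is [y]. *)
Lemma shift_linked x y c : phi y = shift_tiles c (phi x) ->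
  forall n, linked T sigma c (val x) (val y) n.
Proof.
rewrite !(path_tilingE hT) => yx n.
have [t0 yt0 t00] := path_union_origin hT (pathP y).
have xt0 : union (val x) (shift_tile (- c) t0) by move: yt0; rewrite yx shift_tilesE.
have [N hN] := rad_unbounded hT (enorm c).
have /choice[s hs] : forall k, exists s, T 1%N s /\
    forall i, (i <= k + N)%N -> tpath s i = val x i.
  by move=> k; have [s Ts sx] := path_embeds_ex hT (k + N) (pathP x); exists s.
have ag k := path_union_agree hT (pathP x) (hs k).1 (hs k).2.
(* The copy in [T 1] of the tile [t0 - c]; prefixes reach level [k + N] so that this tile lies in
   the ball of agreement. *)
pose s' k := shift_tile (tile_punct (s k)) (shift_tile (- c) t0).
have Ts' k : T 1%N (s' k).
  have : shift_tiles (- tile_punct (s k)) (T 1%N) (shift_tile (- c) t0).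
    by apply/(ag k) => //; rewrite /= t00 add0r enormN; apply: hN; exact: leq_addl.
  by rewrite shift_tilesE /= opprK.
have s'E k : tile_punct (s' k) = tile_punct (s k) - c.
  by rewrite /= t00 add0r addrC.
have zE k : union (tpath (s' k)) =
    shift_tiles c (shift_tiles (- tile_punct (s k)) (T 1%N)).
  by rewrite (path_union_tile hT) // s'E opprB addrC shift_tilesD.
have [|||y' [py' yy' hy']] := @path_union_cluster _ _ _ _ _ hT
    (fun k => tpath (s' k)) (union (val y)).
- by move=> k; exact: (tile_path_in hT).
- exact: (path_union_tiling hT).
- move=> B; have [K hK] := rad_unbounded hT (B + enorm c).
  exists K => k Kk t; rewrite zE yx !(shift_tilesE c) /= => kt tB.
  apply/(ag k) => //=; apply: le_lt_trans (enormD _ _) _; rewrite enormN.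
  have : B + enorm c < rad (k + N) by apply: hK; exact: (leq_trans Kk (leq_addr _ _)).
  by apply: le_lt_trans; rewrite lerD2r.
have yE : y' = val y.
  have : phi (exist _ y' (mem_set py')) = phi y by rewrite !(path_tilingE hT).
  by move=> /hphi <-.
have [k nk ky] := hy' n n.
exists (s k), (s' k); split => //; first by have [] := hs k.
  move=> i im; apply: (hs k).2; apply: leq_trans im _.
  exact: leq_trans nk (leq_addr _ _).
by move=> i im; rewrite ky // yE.
Qed.

Lemma path_equivP x y :
  path_equiv x y <-> exists c, phi y = shift_tiles c (phi x).
Proof.
split=> [/(path_equiv_linked hT)[N [c xy]]|[c /shift_linked xy]].
  by exists c; rewrite !(path_tilingE hT); exact: (linked_shift hT _ _ xy).
exact: (linked_path_equiv hT xy).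
Qed.

Lemma path_tiling_aperiodic x c c' :
  shift_tiles c (phi x) = shift_tiles c' (phi x) -> c = c'.
Proof.
rewrite (path_tilingE hT) => /(congr1 (shift_tiles (- c'))).
rewrite !shift_tilesD subrr shift_tiles0 => /esym/(path_union_aperiodic hT (pathP x)).
by move=> /eqP; rewrite subr_eq0 => /eqP.
Qed.

Lemma path_vectorE x y c : phi y = shift_tiles c (phi x) -> path_vector x y = c.
Proof.
move=> yx; apply: xget_unique => // c' /=; rewrite yx => /path_tiling_aperiodic.
by [].
Qed.

Lemma path_vectorP x y : path_equiv x y ->
  phi y = shift_tiles (path_vector x y) (phi x).
Proof. by move=> /path_equivP[c yx]; rewrite (path_vectorE yx). Qed.

(** Paths with a common prefix have tilings that agree, on a large ball, with the same translate of
    [T 1]. *)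
Lemma path_tiling_continuous : continuous phi.
Proof.
move=> x A /tiling_nbhs_dist[e e0 eA].
pose f := Num.min (e / 2) 2^-1.
have f0 : 0 < f by rewrite lt_min; apply/andP; split; lra.
have [n hn] := rad_unbounded hT f^-1; have {}hn := hn n (leqnn n).
have [s Ts sx] := path_embeds_ex hT n (pathP x).
have xn : nbhs x [set y : is_path | forall i, (i <= n)%N -> val y i = val x i].
  exact: (@initial_continuous _ _ (set_val : is_path -> edge_sequence R d L) x _
    (nbhs_prefix (val x) n)).
apply: filterS xn => y /= yx; apply: eA.
apply: (@le_lt_trans _ _ f); last first.
  by rewrite gt_min; apply/orP; left; lra.
apply: agree_on_dist => //; first by rewrite gt_min; apply/orP; right; lra.
rewrite !(path_tilingE hT); apply: agree_on_le (ltW hn) _.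
apply: agree_on_trans (path_union_agree hT (pathP x) Ts sx) (agree_on_sym _).
apply: (path_union_agree hT (pathP y) Ts) => i im.
exact: etrans (sx i im) (esym (yx i im)).
Qed.

(* Path space is compact, so a failure would produce a second path with the
   same tiling. *)
Lemma path_tiling_inverse x n : exists2 e : R, 0 < e &
  forall y, tiling_dist (phi x) (phi y) < e -> val y n = val x n.
Proof.
apply: contrapT => hx.
have /choice[z hz] : forall k : nat, exists y,
    tiling_dist (phi x) (phi y) < k.+1%:R^-1 /\ val y n <> val x n.
  move=> k; apply: contrapT => hy; apply: hx; exists k.+1%:R^-1 => // y xy.
  by apply: contrapT => yx; apply: hy; exists y.
have [|||y [py yx hy]] := @path_union_cluster _ _ _ _ _ hT
    (fun k => val (z k)) (union (val x)).
- by move=> k; exact: pathP.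
- exact: (path_union_tiling hT).
- move=> B; have r0 := rad_gt0 hT 0.
  (* The term [|B| + 2] absorbs the loss of [1] in the radius of agreement; [2 / rad 0] makes twice
     the distance at most [rad 0]. *)
  pose M := `|B| + 2 + 2 / rad 0.
  have q0 : 0 < 2 / rad 0 by rewrite divr_gt0.
  have B0 := normr_ge0 B; have M0 : 0 < M by rewrite /M; lra.
  exists (Num.bound M) => k Mk t kt tB.
  have kM : M < k.+1%:R.
    apply: (@lt_le_trans _ _ (Num.bound M)%:R).
      by apply: Num.Theory.archi_boundP; exact: ltW.
    by rewrite ler_nat leqW.
  have [xk _] := hz k; rewrite !(path_tilingE hT) in xk.
  have /(path_union_dist hT (pathP x) (pathP (z k)) _ _)ag := xk.
  apply/ag => //.
  + by rewrite invf_le1 // ler1n.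
  + suff h : k.+1%:R^-1 <= rad 0 / 2 by rewrite [leRHS]splitr lerD.
    rewrite -[leRHS]invf_div lef_pV2 ?posrE // ?divr_gt0 //.
    by rewrite /M in kM; lra.
  + rewrite invrK; apply: le_lt_trans tB _; have B1 := ler_norm B.
    by rewrite /M in kM; lra.
have [k _ ky] := hy n 0%N; have [_] := hz k; apply.
rewrite ky //; have : phi (exist _ y (mem_set py)) = phi x.
  by rewrite !(path_tilingE hT).
by move=> /hphi <-.
Qed.

Definition tiling_path (U : Xi) : is_path :=
  sval (cid (path_tiling_surj (set_mem (valP U)))).

Lemma tiling_pathK U : phi (tiling_path U) = val U.
Proof. by rewrite /tiling_path; case: cid. Qed.

Lemma path_tilingK x (p : phi x \in Xi) : tiling_path (exist _ (phi x) p) = x.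
Proof. by apply: hphi; rewrite tiling_pathK. Qed.

(** By [path_tiling_inverse], every edge of the path is locally constant in the tiling. *)
Lemma tiling_path_continuous : continuous tiling_path.
Proof.
apply: continuous_comp_initial => U.
apply: (@edge_sequence_cvg _ _ _ _ _ (@fmap_filter _ _ _ _ (nbhs_filter U))) => n.
have [e e0 he] := path_tiling_inverse (tiling_path U) n.
have Ue : nbhs U [set V : Xi | tiling_dist (val U) (val V) < e].
  exact: (@initial_continuous _ _ (set_val : Xi -> tileset R d L) U _
    (nbhs_tiling_dist (val U) e0)).
by apply: filterS Ue => V /= UV; apply: he; rewrite !tiling_pathK.
Qed.

End Groupoids.

(** * The isomorphism of topological groupoids *)

Section GroupoidIsomorphism.
Variables (R : realType) (d : nat) (L : Type).
Variables (T : nat -> tileset R d L) (sigma : nat -> tile R d L -> tileset R d L).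
Hypothesis hT : proper_nested_sequence T sigma.
Hypothesis hphi : injective (@path_tiling R d L T sigma).

Local Notation is_path := (path_space T sigma).
Local Notation phi := (@path_tiling R d L T sigma).
Local Notation Xi := (canonical_transversal (T 1%N)).
Local Notation BR := (@bratteli_rel R d L T sigma).
Local Notation BM := (bratteli_mor T sigma).
Local Notation TM := (tiling_mor (T 1%N)).
Implicit Types (x y : is_path) (c : 'rV[R]_d).

Definition obj_map x : Xi :=
  exist _ (phi x) (mem_set (path_tiling_transversal hT x)).

Definition obj_inv : Xi -> is_path := tiling_path hT.

Lemma obj_map_continuous : continuous obj_map.
Proof.
by apply: continuous_comp_initial; exact: (path_tiling_continuous hT).
Qed.

Lemma obj_mapK : cancel obj_map obj_inv.
Proof. by move=> x; exact: path_tilingK. Qed.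

Lemma obj_invK : cancel obj_inv obj_map.
Proof. by move=> U; apply: val_inj; exact: tiling_pathK. Qed.

Lemma bratteli_equiv (g : BM) : path_equiv (bratteli_src g) (bratteli_tgt g).
Proof. exact: (set_mem (valP (g : BR))). Qed.

Definition mor_vector (g : BM) : 'rV[R]_d :=
  path_vector (bratteli_src g) (bratteli_tgt g).

Lemma mor_vectorP (g : BM) :
  phi (bratteli_tgt g) = shift_tiles (mor_vector g) (phi (bratteli_src g)).
Proof. exact: (path_vectorP hT hphi (bratteli_equiv g)). Qed.

Lemma mor_map_subproof (g : BM) : TM (phi (bratteli_src g), mor_vector g).
Proof.
by split; rewrite /= -?mor_vectorP; exact: path_tiling_transversal.
Qed.

Definition mor_map (g : BM) : TM :=
  exist (fun m => m \in TM) _ (mem_set (mor_map_subproof g)).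

Lemma mor_inv_subproof (m : TM) :
  BR (obj_inv (tiling_src m), obj_inv (tiling_tgt m)).
Proof.
apply/(path_equivP hT hphi); exists (val m).2.
by rewrite /= !tiling_pathK.
Qed.

Definition mor_inv (m : TM) : BM :=
  (exist (fun g => g \in BR) _ (mem_set (mor_inv_subproof m)) : BR).

Lemma mor_inv_vector (m : TM) : mor_vector (mor_inv m) = (val m).2.
Proof. by apply: (path_vectorE hT); rewrite /= !tiling_pathK. Qed.

Lemma mor_map_src g : tiling_src (mor_map g) = obj_map (bratteli_src g).
Proof. exact: val_inj. Qed.

Lemma mor_map_tgt g : tiling_tgt (mor_map g) = obj_map (bratteli_tgt g).
Proof. by apply: val_inj; rewrite /= mor_vectorP. Qed.

Lemma mor_mapK : cancel mor_map mor_inv.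
Proof.
move=> g; apply: (@val_inj _ _ (BR)).
rewrite [LHS]/= mor_map_src mor_map_tgt !obj_mapK.
by rewrite /bratteli_src /bratteli_tgt; case: (val (g : BR)).
Qed.

Lemma mor_invK : cancel mor_inv mor_map.
Proof.
move=> m; apply: val_inj; rewrite [LHS]/= mor_inv_vector tiling_pathK.
by rewrite /=; case: (val m).
Qed.

(** Both components factor through the pair of source and vector, for which the topology of [BM] is
    initial. *)
Lemma mor_map_continuous : continuous mor_map.
Proof.
apply: continuous_comp_initial => g.
have cg : {for g, continuous (fun g : BM => (bratteli_src g, mor_vector g))}.
  exact: (@initial_continuous _ _ (fun g : BR =>
    ((val g).1, path_vector (val g).1 (val g).2) : is_path * 'rV[R]_d) g).
have c1 : {for g, continuous (phi \o @bratteli_src R d L T sigma)}.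
  apply: (@continuous_comp BM is_path _ (@bratteli_src _ _ _ T sigma) phi).
    exact: (cvg_comp _ _ cg cvg_fst).
  exact: (path_tiling_continuous hT).
have c2 : {for g, continuous mor_vector}.
  exact: (cvg_comp _ _ cg (@cvg_snd _ _ _ _ (nbhs_filter _))).
exact: (@cvg_pair _ _ _ _ (nbhs (phi (bratteli_src g))) (nbhs (mor_vector g))
  (nbhs_filter _) (nbhs_filter _) (nbhs_filter _) _ _ c1 c2).
Qed.

Lemma mor_inv_continuous : continuous mor_inv.
Proof.
apply: continuous_comp_initial => m.
have cm : continuous (set_val : TM -> tileset R d L * 'rV[R]_d).
  exact: initial_continuous.
have csrc : continuous (@tiling_src R d L (T 1%N)).
  apply: continuous_comp_initial => m'.
  exact: (cvg_comp _ _ (cm m') (@cvg_fst _ _ _ _ (nbhs_filter _))).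
have -> : (fun g : BR =>
    ((val g).1, path_vector (val g).1 (val g).2) : is_path * 'rV[R]_d) \o mor_inv
  = fun m => (obj_inv (tiling_src m), (val m).2).
  by apply/funext => m' /=; congr pair; exact: mor_inv_vector.
have c1 : {for m, continuous (obj_inv \o @tiling_src R d L (T 1%N))}.
  apply: (@continuous_comp TM Xi _ (@tiling_src R d L (T 1%N)) obj_inv).
    exact: csrc.
  exact: (tiling_path_continuous hphi).
have c2 : {for m, continuous (fun m : TM => (val m).2)}.
  exact: (cvg_comp _ _ (cm m) (@cvg_snd _ _ _ _ (nbhs_filter _))).
exact: (@cvg_pair _ _ _ _ (nbhs (obj_inv (tiling_src m))) (nbhs (val m).2)
  (nbhs_filter _) (nbhs_filter _) (nbhs_filter _) _ _ c1 c2).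
Qed.

(** Vectors add under composition. Aperiodicity makes the vector unique in one direction; in the
    other, equal tilings have equal paths. *)
Lemma mor_map_comp (g h k : BM) :
  bratteli_comp g h k <-> tiling_comp (mor_map g) (mor_map h) (mor_map k).
Proof.
have obj_inj : injective obj_map by exact: can_inj obj_mapK.
have add x y z c c' : phi y = shift_tiles c (phi x) ->
    phi z = shift_tiles c' (phi y) -> phi z = shift_tiles (c + c') (phi x).
  by move=> -> ->; rewrite shift_tilesD.
rewrite /tiling_comp mor_map_tgt !mor_map_src; split.
  move=> [gh kg kh]; rewrite gh kg; split=> //=.
  apply: (path_vectorE hT); rewrite kg kh.
  by apply: (add _ (bratteli_tgt g)); rewrite ?[in RHS]gh mor_vectorP.
move=> [/obj_inj gh /obj_inj kg /= kv]; split=> //; apply: hphi.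
rewrite mor_vectorP kv kg; apply/esym.
by apply: (add _ (bratteli_tgt g)); rewrite ?[in RHS]gh mor_vectorP.
Qed.

End GroupoidIsomorphism.

Theorem corollary3p23 (R : realType) (d : nat) (L : Type)
    (T : nat -> tileset R d L) (sigma : nat -> tile R d L -> tileset R d L)
    (hT : proper_nested_sequence T sigma)
    (hphi : injective (@path_tiling R d L T sigma)) :
  groupoid_homeomorphic (@bratteli_groupoid R d L T sigma)
    (@tiling_groupoid R d L (T 1%N)).
Proof.
exists (obj_map hT), (mor_map hT hphi); split.
- split; split.
  + exact: obj_map_continuous.
  + exists (obj_inv hT); split; last exact: obj_invK.
      exact: (tiling_path_continuous hphi).
    exact: obj_mapK.
  + exact: mor_map_continuous.
  + exists (mor_inv hT hphi); split; last exact: mor_invK.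
      exact: mor_inv_continuous.
    exact: mor_mapK.
- exact: mor_map_src.
- exact: mor_map_tgt.
- exact: mor_map_comp.
Qed.
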